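(* Let $H$ be a complex separable Hilbert space and $T=(T_1,\ldots,T_d)$ be a commuting operator-valued multishift on $\ell^2_H(\mathbb N^d)$ with invertible operator weights $\{A^{(j)}_\alpha:\alpha\in\mathbb N^d,\ j=1,\ldots,d\}$. Let $\mathscr B=\{B_\alpha:\alpha\in\mathbb N^d\}$ be the associated multisequence of moments, let $\Omega$ be the set of all bounded point evaluations on $\mathcal H^2(\mathscr B)$, and let $\mathcal H(\kappa)$ be the associated reproducing kernel Hilbert space of $H$-valued functions on $\Omega$, with $\mathscr M_z=(\mathscr M_{z_1},\dots,\mathscr M_{z_d})$ the tuple of multiplication operators by the coordinate functions on $\mathcal H(\kappa)$. Then for every $w\in\Omega$, $\ker(\mathscr M_z^*-\overline w)=\{\kappa(\cdot,w)x:x\in H\}$, and $$\bigvee_{w\in\Omega}\ker(\mathscr M_z^*-\overline w)=\mathcal H(\kappa).$$ Moreover, if $\Omega$ has non-empty interior, then $T$ is unitarily equivalent to the $d$-tuple $\mathscr M_z=(\mathscr M_{z_1},\ldots,\mathscr M_{z_d})$ of multiplication operators by the coordinate functions on $\mathcal H(\kappa)$.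
   Context: $\mathbb N$ is the set of non-negative integers, $d\ge1$, and $\varepsilon_j\in\mathbb N^d$ has $1$ in the $j$th place and $0$ elsewhere. $\ell^2_H(\mathbb N^d)=\oplus_{\alpha\in\mathbb N^d}H$. Given invertible bounded operators $A^{(j)}_\alpha$ on $H$, the operator-valued multishift $T=(T_1,\dots,T_d)$ on $\ell^2_H(\mathbb N^d)$ with these weights is $T_j(\oplus_\alpha x_\alpha)=\oplus_\alpha A^{(j)}_{\alpha-\varepsilon_j}x_{\alpha-\varepsilon_j}$, where the $\alpha$-entry is $0$ if $\alpha_j=0$. It is commuting if $\sup_\alpha\|A^{(j)}_\alpha\|<\infty$ for every $j$ (equivalently each $T_j$ is bounded) and $A^{(i)}_{\alpha+\varepsilon_j}A^{(j)}_\alpha=A^{(j)}_{\alpha+\varepsilon_i}A^{(i)}_\alpha$ for all $\alpha,i,j$ (equivalently the $T_j$ commute). Moments: $A^{(j)}(\alpha,k)=A^{(j)}_{\alpha-\varepsilon_j}A^{(j)}_{\alpha-2\varepsilon_j}\cdots A^{(j)}_{\alpha-k\varepsilon_j}$ for $1\le k\le\alpha_j$, $A^{(j)}(\alpha,0)=I$, and $$B_\alpha=A^{(1)}(\alpha,\alpha_1)\,A^{(2)}(\alpha-\alpha_1\varepsilon_1,\alpha_2)\cdots A^{(d)}\Big(\alpha-\sum_{l=1}^{d-1}\alpha_l\varepsilon_l,\ \alpha_d\Big),$$ an invertible bounded operator on $H$. $\mathcal H^2(\mathscr B)$ is the Hilbert space of formal power series $\sum_{\alpha\in\mathbb N^d}x_\alpha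 z^\alpha$, $x_\alpha\in H$, with $\sum_\alpha\|B_\alpha x_\alpha\|^2<\infty$, with inner product $\langle\sum x_\alpha z^\alpha,\sum y_\alpha z^\alpha\rangle=\sum_\alpha\langle B_\alpha x_\alpha,B_\alpha y_\alpha\rangle_H$. A point $w\in\mathbb C^d$ is a bounded point evaluation on $\mathcal H^2(\mathscr B)$ if the map $E_w:p\mapsto p(w)$ from the $H$-valued polynomials in $\mathcal H^2(\mathscr B)$ to $H$ extends to a continuous linear map $E_w:\mathcal H^2(\mathscr B)\to H$. For $w\in\Omega$ and $f\in\mathcal H^2(\mathscr B)$ put $f(w):=E_wf$, so $f$ defines a function $f|_\Omega:\Omega\to H$. $\mathcal H(\kappa)=\{f|_\Omega:f\in\mathcal H^2(\mathscr B)\}$ with the inner product inherited from $\mathcal H^2(\mathscr B)$, i.e. the one for which $f\mapsto f|_\Omega$ is unitary from the orthogonal complement of $\{f: f|_\Omega=0\}$ onto $\mathcal H(\kappa)$ (if $f\mapsto f|_\Omega$ is injective, in particular if $\Omega$ has non-empty interior, this is simply the inner product of $\mathcal H^2(\mathscr B)$). It is a reproducing kernel Hilbert space with $\mathcal B(H)$-valued kernel $\kappa(z,w)=E_zE_w^*=\sum_{\alpha\in\mathbb N^d}(B_\alpha^*B_\alpha)^{-1}z^\alpha\overline w^\alpha$, $z,w\in\Omega$ (strong convergence). $(\mathscr M_{z_j}f)(z)=z_jf(z)$ defines bounded operators on $\mathcal H(\kappa)$. $\ker(\mathscr M_z^*-\overline w)=\bigcap_{j}\ker(\mathscr M_{z_j}^*-\overline{w_j}I)$;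 $\bigvee$ denotes closed linear span. Two $d$-tuples $S$ on $\mathcal K$ and $T$ on $\mathcal H$ are unitarily equivalent if there is a unitary $U:\mathcal K\to\mathcal H$ with $US_j=T_jU$ for all $j$. *)

(* Defs.v *)
From HB Require Import structures.
From mathcomp Require Import all_boot all_order all_algebra.
From mathcomp Require Import all_classical all_reals all_analysis.
From mathcomp Require Import complex.
From mathcomp Require analysis.showcase.summability.

Set Implicit Arguments.
Unset Strict Implicit.
Unset Printing Implicit Defensive.

Import Order.TTheory GRing.Theory Num.Theory.
Import numFieldNormedType.Exports.

Local Open Scope classical_set_scope.
Local Open Scope ring_scope.
Local Open Scope complex_scope.

(** Hilbert spaces of families and of functions are presented inside an ambient
    vector space: [hcar] is the set of elements of the space and [hdot] its inner
    product, linear in the first argument.  The values of [hdot], and of the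
    maps below, are irrelevant outside [hcar]. *)
Record hspace (R : realType) := HSpace {
  hamb :> lmodType R[i];
  hcar : set hamb;
  hdot : hamb -> hamb -> R[i] }.

Section HilbertSpaces.
Variable R : realType.
Implicit Types K L : hspace R.

Definition hnorm K (x : K) : R := Num.sqrt (complex.Re (hdot x x)).

Definition hlinear K L (f : K -> L) :=
  forall (a : R[i]) (x y : K), hcar x -> hcar y ->
    f (a *: x + y) = a *: f x + f y.

Definition hcontinuous K L (f : K -> L) :=
  forall x : K, hcar x -> forall e : R, 0 < e ->
    exists2 r : R, 0 < r &
      forall y : K, hcar y -> hnorm (y - x) < r -> hnorm (f y - f x) < e.

(** The Hilbert space adjoint: by the Riesz theorem, for bounded [f] exactly one
    vector qualifies. *)
Definition hadjoint K L (f : K -> L) (y : L) : K :=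
  xget 0 [set x : K | hcar x /\
                      forall u : K, hcar u -> hdot (f u) y = hdot u x].

Definition linear_span K (S : set K) : set K :=
  [set x | exists (n : nat) (c : 'I_n -> R[i]) (v : 'I_n -> K),
     (forall i, S (v i)) /\ x = \sum_(i < n) c i *: v i].

Definition closed_span K (S : set K) : set K :=
  [set x | hcar x /\ forall e : R, 0 < e ->
     exists2 y, linear_span S y & hnorm (x - y) < e].

(** [\bigcap_j ker (S_j - c_j I)]. *)
Definition joint_ker K d (S : 'I_d -> K -> K) (c : 'rV[R[i]]_d) : set K :=
  [set x | hcar x /\ forall j, S j x - c 0 j *: x = 0].

Definition unitary K L (U : K -> L) :=
  [/\ hlinear U, U @` @hcar _ K = @hcar _ L &
      forall x y : K, hcar x -> hcar y -> hdot (U x) (U y) = hdot x y].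

Definition unitarily_equivalent K L d (S : 'I_d -> K -> K) (T : 'I_d -> L -> L) :=
  exists U : K -> L, unitary U /\
    forall j (x : K), hcar x -> U (S j x) = T j (U x).

End HilbertSpaces.

Section MultiIndices.
Variable d : nat.

Definition mindex := {ffun 'I_d -> nat}.

Definition eps (j : 'I_d) : mindex := [ffun i => (i == j : nat)].

(** Only used for [b <= a]; truncated otherwise. *)
Definition msub (a b : mindex) : mindex := [ffun i => (a i - b i)%N].

End MultiIndices.

Section Multishift.
Variables (R : realType) (H : completeNormedModType R[i]).
Variable dot : {dot H for (Num.conj : R[i] -> R[i])}.
Variable d : nat.

Definition full_hspace : hspace R := HSpace setT dot.

Definition opnorm (f : H -> H) : \bar R :=
  ereal_sup [set (complex.Re `|f x|)%:E | x in [set x : H | `|x| <= 1]].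

Definition invertible_operator (f : {linear H -> H}) :=
  continuous f /\
  exists g : {linear H -> H}, [/\ continuous g, cancel f g & cancel g f].

Definition commuting_multishift (A : 'I_d -> mindex d -> {linear H -> H}) :=
  (forall j, (ereal_sup [set opnorm (A j a) | a in [set: mindex d]] < +oo)%E) /\
  (forall a i j, A i (a + eps j) \o A j a = A j (a + eps i) \o A i a).

(** The space of families [x] with [\sum_a |W_a x_a|^2 < oo] and inner product
    [\sum_a <W_a x_a, W_a y_a>] (unconditional sum).  A formal power series is
    identified with the family of its coefficients. *)
Definition weighted_l2 (W : mindex d -> H -> H) : hspace R :=
  @HSpace R (mindex d -> H)
    [set x | (\esum_(a in [set: mindex d])
                ((complex.Re `|W a (x a)|) ^+ 2)%:E < +oo)%E]
    (fun x y => summability.sum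
                  (fun a => dot (W a (x a)) (W a (y a)) : R[i]^o)).

Definition l2 : hspace R := weighted_l2 (fun _ => id).

Definition monomial (w : 'rV[R[i]^o]_d) (a : mindex d) : R[i] :=
  \prod_(j < d) (w 0 j : R[i]) ^+ a j.

Definition is_polynomial (p : mindex d -> H) := finite_set [set a | p a != 0].

Definition poly_eval (w : 'rV[R[i]^o]_d) (p : mindex d -> H) : H :=
  \sum_(a \in [set: mindex d]) monomial w a *: p a.

Variable A : 'I_d -> mindex d -> {linear H -> H}.

Definition multishift (j : 'I_d) (x : l2) : l2 :=
  fun a => if a j == 0%N then 0
           else A j (msub a (eps j)) (x (msub a (eps j))).

Definition partial_moment (j : 'I_d) (a : mindex d) (k : nat) : H -> H :=
  \big[(fun f g => f \o g)/id]_(1 <= i < k.+1)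
    (A j (msub a (eps j *+ i)) : H -> H).

Definition moment (a : mindex d) : H -> H :=
  \big[(fun f g => f \o g)/id]_(j < d)
    partial_moment j (msub a (\sum_(l < d | (l < j)%N) eps l *+ a l)) (a j).

Definition H2 : hspace R := weighted_l2 moment.

Definition is_eval (w : 'rV[R[i]^o]_d) (E : H2 -> full_hspace) :=
  [/\ hlinear E, hcontinuous E &
      forall p : H2, is_polynomial p -> E p = poly_eval w p].

Definition bpe : set 'rV[R[i]^o]_d := [set w | exists E, is_eval w E].

(** [E_w], for [w] in [bpe]; unique on [H2] since polynomials are dense. *)
Definition eval (w : 'rV[R[i]^o]_d) : H2 -> full_hspace :=
  xget (fun _ => 0) [set E | is_eval w E].

Definition restriction (f : H2) : bpe -> H := fun w => eval (val w) f.

(** The representative of [F] orthogonal to all [g] vanishing on [bpe]. *)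
Definition min_lift (F : bpe -> H) : H2 :=
  xget 0 [set f : H2 | [/\ hcar f, restriction f = F &
    forall g : H2, hcar g -> restriction g = 0 -> hdot f g = 0]].

Definition Hkappa : hspace R :=
  @HSpace R (bpe -> H) (restriction @` @hcar _ H2)
    (fun F G => hdot (min_lift F) (min_lift G)).

Definition kappa (z w : 'rV[R[i]^o]_d) : H -> H :=
  eval z \o hadjoint (@eval w).

Definition kappa_at (w : 'rV[R[i]^o]_d) (x : H) : Hkappa :=
  fun z : bpe => kappa (val z) w x.

Definition Mz (j : 'I_d) (F : Hkappa) : Hkappa :=
  fun z : bpe => ((val z : 'rV_d) 0 j : R[i]) *: F z.

End Multishift.

(* Main.v *)
Require Import Defs.
From HB Require Import structures.
From mathcomp Require Import all_boot all_order all_algebra finmap.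
From mathcomp Require Import all_classical all_reals all_analysis.
From mathcomp Require Import complex ring lra zify.
From mathcomp Require analysis.showcase.summability.
Set Implicit Arguments.
Unset Strict Implicit.
Unset Printing Implicit Defensive.
Import Order.TTheory GRing.Theory Num.Theory.
Import numFieldNormedType.Exports.
Local Open Scope classical_set_scope.
Local Open Scope ring_scope.
Local Open Scope complex_scope.

(** Everything is computed on power series.  An element of [Hkappa] is the
    restriction of a unique series orthogonal to the space of series vanishing
    on [bpe] ([min_liftP]), and pairing a restriction with such a lift is the
    pairing of series ([Hkappa_dot]).  The Riesz theorem on [H2] gives a series
    [g] with [dot (eval w f) x = hdot f g] for all [f]; this [g] is orthogonal
    to the vanishing series and restricts to [kappa_at w x].

    Joint kernel.  The moments satisfy [B_(a + eps j) = A j a B_a], because the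
    weights commute ([moment_eps]); as the weights are uniformly bounded,
    multiplication by [z_j] is bounded on [H2] ([zmul_bounded]), and
    [eval w (z_j f) = w_j eval w f] by density of the polynomials
    ([eval_zmul]).  Hence every [kappa_at w x] is a joint eigenvector.
    Conversely, let [f] be the lift of a joint eigenvector.  Then
    [hdot (z_j g) f = w_j hdot g f] for all [g], so by induction on [b]
    [hdot (x z^b) f = w^b dot x (f 0)], which is also the pairing of [x z^b]
    with the representer of [g |-> dot (eval w g) (f 0)]; by density [f] is
    that representer ([joint_eigenvector]).

    Density.  If [f] is orthogonal to the vanishing series, the component of
    [f] orthogonal to all representers vanishes at every point of [bpe], so it
    is orthogonal to [f] and therefore zero ([closed_span_kappa]).

    Unitary equivalence.  Applying [B_a^-1] coefficientwise is a unitary from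
    [l2] onto [H2] that turns the multishift into multiplication by the [z_j],
    so it remains to see that a series [f] vanishing on [bpe] is zero when
    [bpe] has an interior point ([restriction_injective]).  Scaling one
    coordinate of the point by [t] in [[0, 1]] corresponds to the contraction
    [f |-> (t ^ (a j) f_a)_a], so [bpe] is stable under this scaling and the
    space of vanishing series is stable under these contractions.  Letting [t]
    tend to [0] after division by [t ^ k] isolates the part of lowest degree
    [k] in [z_j] ([vanishing_lowest]).  Peeling off degrees one at a time, in
    each variable in turn, shows that every monomial [f_b z^b] of [f] vanishes
    on [bpe] ([vanishing_mono]); evaluating at a point with nonzero
    coordinates gives [f_b = 0]. *)

(** * Real-valued norms over the complex numbers *)

Section RealNorm.
Variable R : realType.

(** Norms over [R[i]] take values in [R[i]]; estimates are made on their real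
    part, where the order is total. *)
Definition nrm (V : normedZmodType R[i]) (x : V) : R := complex.Re `|x|.

Section Normed.
Variable V : normedZmodType R[i].
Implicit Types x y : V.

Lemma nrmE x : (nrm x)%:C = `|x|.
Proof. by rewrite /nrm RRe_real// normr_real. Qed.

Lemma nrm_ge0 x : 0 <= nrm x.
Proof. by rewrite -lecR nrmE normr_ge0. Qed.

Lemma nrm0 : nrm (0 : V) = 0.
Proof. by apply: complexI; rewrite nrmE normr0. Qed.

Lemma nrm_eq0 x : nrm x = 0 -> x = 0.
Proof. by move=> x0; apply/eqP; rewrite -normr_eq0 -nrmE x0. Qed.

Lemma nrmD x y : nrm (x + y) <= nrm x + nrm y.
Proof. by rewrite -lecR rmorphD /= !nrmE ler_normD. Qed.

Lemma nrmN x : nrm (- x) = nrm x.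
Proof. by rewrite /nrm normrN. Qed.

Lemma nrmB x y : nrm (x - y) = nrm (y - x).
Proof. by rewrite /nrm distrC. Qed.

End Normed.

Lemma nrmZ (V : normedModType R[i]) (a : R[i]) (x : V) :
  nrm (a *: x) = nrm a * nrm x.
Proof. by apply: complexI; rewrite rmorphM /= !nrmE normrZ. Qed.

Lemma nrmM (a b : R[i]) : nrm (a * b) = nrm a * nrm b.
Proof. by apply: complexI; rewrite rmorphM /= !nrmE normrM. Qed.

Lemma nrm_real (a : R) : nrm (a%:C) = `|a|.
Proof. by rewrite /nrm normc_def /= expr0n addr0 sqrtr_sqr. Qed.

Lemma mul_conjC (z : R[i]) : z * Num.conj z = (nrm z ^+ 2)%:C.
Proof. by rewrite rmorphXn /= nrmE normCK. Qed.

End RealNorm.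

(** * Projection and representation in Hilbert spaces *)

Section HilbertSpace.
Variables (R : realType) (K : hspace R).
Implicit Types x y z : K.

Definition hlim (u : nat -> K) (x : K) :=
  forall e : R, 0 < e -> exists N, forall n, (N <= n)%N -> hnorm (u n - x) < e.

Definition hcauchy (u : nat -> K) :=
  forall e : R, 0 < e -> exists N, forall m n, (N <= m)%N -> (N <= n)%N ->
    hnorm (u m - u n) < e.

(** The axioms only constrain vectors of [hcar], as the inner product of an
    [hspace] is arbitrary outside it. *)
Record prehilbert : Prop := Prehilbert {
  hilbert0 : hcar (0 : K);
  hilbertP : forall (a : R[i]) x y, hcar x -> hcar y -> hcar (a *: x + y);
  hilbert_dotP : forall (a : R[i]) x y z, hcar x -> hcar y -> hcar z ->
    hdot (a *: x + y) z = a * hdot x z + hdot y z;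
  hilbert_dotC : forall x y, hcar x -> hcar y ->
    hdot y x = Num.conj (hdot x y);
  hilbert_dot_ge0 : forall x, hcar x -> 0 <= hdot x x;
  hilbert_dot_eq0 : forall x, hcar x -> hdot x x = 0 -> x = 0 }.

Definition hcomplete := forall u : nat -> K, (forall n, hcar (u n)) ->
    hcauchy u -> exists2 x, hcar x & hlim u x.

Definition hclosure (V : set K) : set K :=
  [set x | hcar x /\ forall e : R, 0 < e -> exists2 v, V v & hnorm (x - v) < e].

Record hsubspace (V : set K) : Prop := HSubspace {
  hsubspace_car : V `<=` @hcar _ K;
  hsubspace0 : V 0;
  hsubspaceP : forall (a : R[i]) x y, V x -> V y -> V (a *: x + y) }.

Hypothesis hK : prehilbert.
Let car0 := hilbert0 hK.
Let carP := hilbertP hK.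

Lemma hcarD x y : hcar x -> hcar y -> hcar (x + y).
Proof. by move=> /carP h /h => /(_ 1); rewrite scale1r. Qed.

Lemma hcarZ a x : hcar x -> hcar (a *: x).
Proof. by move=> /carP /(_ car0) => /(_ a); rewrite addr0. Qed.

Lemma hcarB x y : hcar x -> hcar y -> hcar (x - y).
Proof. by move=> hx hy; rewrite addrC -scaleN1r; exact: carP. Qed.

Lemma hdotDl x y z : hcar x -> hcar y -> hcar z ->
  hdot (x + y) z = hdot x z + hdot y z.
Proof.
by move=> hx hy hz; rewrite -[x in LHS]scale1r hilbert_dotP// mul1r.
Qed.

Lemma hdot0l z : hcar z -> hdot 0 z = 0.
Proof.
move=> hz; have := hdotDl car0 car0 hz; rewrite addr0 => /eqP.
by rewrite -subr_eq0 opprD addNKr oppr_eq0 => /eqP.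
Qed.

Lemma hdotZl a x z : hcar x -> hcar z -> hdot (a *: x) z = a * hdot x z.
Proof.
by move=> hx hz; rewrite -[a *: x]addr0 hilbert_dotP// hdot0l// addr0.
Qed.

Lemma hdotBl x y z : hcar x -> hcar y -> hcar z ->
  hdot (x - y) z = hdot x z - hdot y z.
Proof.
by move=> hx hy hz; rewrite addrC -scaleN1r hilbert_dotP// mulN1r addrC.
Qed.

Lemma hdotBr x y z : hcar x -> hcar y -> hcar z ->
  hdot z (x - y) = hdot z x - hdot z y.
Proof.
move=> hx hy hz; rewrite (hilbert_dotC hK)//; last exact: hcarB.
by rewrite hdotBl// rmorphB /= -!hilbert_dotC.
Qed.

Lemma hdotZr a x z : hcar x -> hcar z ->
  hdot z (a *: x) = Num.conj a * hdot z x.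
Proof.
move=> hx hz; rewrite (hilbert_dotC hK)//; last exact: hcarZ.
by rewrite hdotZl// rmorphM /= -!hilbert_dotC.
Qed.

Lemma hnorm_sqr x : hcar x -> (hnorm x ^+ 2)%:C = hdot x x.
Proof.
move=> /(hilbert_dot_ge0 hK) x0; rewrite /hnorm sqr_sqrtr.
  by rewrite RRe_real// ger0_real.
by move: x0; rewrite lecE => /andP[].
Qed.

Lemma hnorm_ge0 x : 0 <= hnorm x. Proof. exact: sqrtr_ge0. Qed.

Lemma hnorm_eq0 x : hcar x -> hnorm x = 0 -> x = 0.
Proof.
move=> hx x0; apply: (hilbert_dot_eq0 hK) => //.
by rewrite -hnorm_sqr// x0 expr0n.
Qed.

Lemma hnormZ a x : hcar x -> hnorm (a *: x) = nrm a * hnorm x.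
Proof.
move=> hx; apply/eqP; rewrite -(@eqrXn2 _ 2)// ?mulr_ge0 ?hnorm_ge0 ?nrm_ge0//.
apply/eqP/complexI; rewrite hnorm_sqr ?hdotZl ?hdotZr//; try exact: hcarZ.
by rewrite exprMn rmorphM /= -mul_conjC mulrA hnorm_sqr.
Qed.

Lemma hnormN x : hcar x -> hnorm (- x) = hnorm x.
Proof.
by move=> hx; rewrite -scaleN1r hnormZ// /nrm normrN1 mul1r.
Qed.

Lemma hnormB x y : hcar x -> hcar y -> hnorm (x - y) = hnorm (y - x).
Proof. by move=> hx hy; rewrite -hnormN ?opprB//; exact: hcarB. Qed.

(** Optimising the multiple [t] of [v] subtracted from [x]: for [d = 0] this is
    the Cauchy-Schwarz inequality, and when [d] is the squared distance from
    [x] to a subspace it says that almost minimal vectors are almost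
    orthogonal to that subspace. *)
Lemma hdot_le_of_almost_minimal (x v : K) (d e : R) : hcar x -> hcar v ->
  0 <= e -> (forall t : R[i], d <= hnorm (x - t *: v) ^+ 2) ->
  hnorm x ^+ 2 <= d + e ^+ 2 -> nrm (hdot x v) <= e * hnorm v.
Proof.
move=> hx hv e0 dmin xde.
have [v0|v0] := eqVneq (hnorm v) 0.
  rewrite v0 mulr0 (hnorm_eq0 hv v0).
  by rewrite (hilbert_dotC hK)// hdot0l// rmorph0 nrm0.
have v_gt0 : 0 < hnorm v by rewrite lt_def v0 hnorm_ge0.
set c := hdot x v.
have vv0 : (hnorm v ^+ 2)%:C != 0 :> R[i].
  by apply/eqP => /complexI /eqP; rewrite expf_eq0 (negPf v0).
have hcv t : hcar (t *: v) by exact: hcarZ.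
have key : hnorm (x - (c / (hnorm v ^+ 2)%:C) *: v) ^+ 2 =
    hnorm x ^+ 2 - nrm c ^+ 2 / hnorm v ^+ 2.
  apply: complexI; rewrite [LHS]hnorm_sqr; last exact: hcarB.
  rewrite hdotBl ?hdotBr ?hdotZr ?hdotZl//; try exact: hcarB.
  rewrite ?hdotZr// (hilbert_dotC hK hx hv) -/c -[hdot x x]hnorm_sqr//.
  rewrite -[hdot v v]hnorm_sqr//.
  have -> : (hnorm x ^+ 2 - nrm c ^+ 2 / hnorm v ^+ 2)%:C =
      (hnorm x ^+ 2)%:C - c * Num.conj c / (hnorm v ^+ 2)%:C.
    by rewrite mul_conjC rmorphB fmorph_div.
  have -> : Num.conj (c / (hnorm v ^+ 2)%:C) = Num.conj c / (hnorm v ^+ 2)%:C.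
    rewrite rmorphM fmorphV /=; congr (_ / _).
    by apply: conj_Creal; rewrite complex_real.
  have E (F : fieldType) (a b b' s : F) : s != 0 ->
      a - b' / s * b - (b / s * b' - b' / s * (b / s * s)) = a - b * b' / s.
    by move=> s0; field.
  exact: E.
have := dmin (c / (hnorm v ^+ 2)%:C); rewrite key => dle.
rewrite -(@ler_pXn2r _ 2)// ?nnegrE ?nrm_ge0 ?mulr_ge0 ?hnorm_ge0//.
rewrite exprMn -ler_pdivrMr ?exprn_gt0//.
lra.
Qed.

Lemma hcauchy_schwarz x y : hcar x -> hcar y ->
  nrm (hdot x y) <= hnorm x * hnorm y.
Proof.
move=> hx hy; apply: (@hdot_le_of_almost_minimal _ _ 0); rewrite ?hnorm_ge0//.
  by move=> t; rewrite exprn_ge0 ?hnorm_ge0.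
by rewrite add0r.
Qed.

(** A bounded additive map is continuous; additivity is only known on [hcar],
    so the usual topological statement is replaced by this one. *)
Lemma closure_vanish (U : normedZmodType R[i]) (phi : K -> U) (C : R)
    (V : set K) p :
  (forall x y, hcar x -> hcar y -> phi (x + y) = phi x + phi y) ->
  (forall x, hcar x -> nrm (phi x) <= C * hnorm x) ->
  V `<=` @hcar _ K -> (forall v, V v -> phi v = 0) ->
  hclosure V p -> phi p = 0.
Proof.
move=> phiD phiC Vcar phiV [hp pV].
apply: nrm_eq0; apply/eqP; rewrite eq_le nrm_ge0 andbT.
apply/ler_addgt0Pr => e e0; rewrite add0r.
have C0 : 0 < `|C| + 1 by rewrite ltr_wpDl.
have [v Vv pv] := pV (e / (`|C| + 1)) (divr_gt0 e0 C0).
have hv := Vcar v Vv; have hpv := hcarB hp hv.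
have -> : phi p = phi (p - v).
  by have := phiD _ _ hpv hv; rewrite subrK (phiV v Vv) addr0.
apply: le_trans (phiC _ hpv) _.
apply: (@le_trans _ _ ((`|C| + 1) * hnorm (p - v))).
  by rewrite ler_wpM2r ?hnorm_ge0// (le_trans (ler_norm C))// lerDl.
by rewrite mulrC -ler_pdivlMr// ltW.
Qed.

Lemma hclosure_orth (V : set K) z p : hcar z -> V `<=` @hcar _ K ->
  (forall v, V v -> hdot v z = 0) -> hclosure V p -> hdot p z = 0.
Proof.
move=> hz; apply: (@closure_vanish _ (fun x => hdot x z) (hnorm z)) => x y.
  by move=> hx hy; exact: hdotDl.
by rewrite mulrC; apply: hcauchy_schwarz.
Qed.

Lemma linear_span_subspace (S : set K) : S `<=` @hcar _ K ->
  hsubspace (linear_span S).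
Proof.
move=> Scar; split.
- move=> _ [n [c [v [Sv ->]]]]; elim/big_ind: _ => [//|x y hx hy|i _].
    exact: hcarD.
  by apply: hcarZ; exact: Scar.
- by exists 0%N, (fun _ => 0), (fun _ => 0); split=> [[]//|]; rewrite big_ord0.
- move=> a _ _ [n [c [v [Sv ->]]]] [m [c' [v' [Sv' ->]]]].
  exists (n + m)%N.
  exists (fun k => match fintype.split k with inl i => a * c i | inr j => c' j end).
  exists (fun k => match fintype.split k with inl i => v i | inr j => v' j end).
  split=> [k|]; first by case: (fintype.split k).
  rewrite big_split_ord scaler_sumr; congr (_ + _); apply: eq_bigr => i _.
    by rewrite -[lshift _ _]/(unsplit (inl i)) unsplitK scalerA.
  by rewrite -[rshift _ _]/(unsplit (inr i)) unsplitK.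
Qed.

Lemma linear_span_min (S V : set K) : hsubspace V -> S `<=` V ->
  linear_span S `<=` V.
Proof.
move=> VS SV _ [n [c [v [Sv ->]]]]; elim/big_ind: _ => [|x y Vx Vy|i _].
- exact: hsubspace0 VS.
- by rewrite -[x]scale1r; exact: (hsubspaceP VS).
- rewrite -[_ *: _]addr0; apply: (hsubspaceP VS); first exact: SV.
  exact: hsubspace0 VS.
Qed.

Hypothesis hcompl : hcomplete.

(** Almost minimising vectors form a Cauchy sequence because each of their
    differences [w] lies in [V], to which both residues are almost
    orthogonal, while [hdot w w] is the difference of the two pairings. *)
Theorem hprojection (V : set K) x : hsubspace V -> hcar x ->
  exists p, hclosure V p /\ forall v, V v -> hdot (x - p) v = 0.
Proof.
move=> [Vcar V0 VP] hx.
pose D := [set hnorm (x - v) ^+ 2 | v in V].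
have Dlb : has_inf D.
  split; first by exists (hnorm (x - 0) ^+ 2); exists 0.
  by exists 0 => _ [v _ <-]; rewrite exprn_ge0 ?hnorm_ge0.
pose r n : R := n.+1%:R^-1.
have r0 n : 0 < r n by rewrite invr_gt0.
have ex n : exists v, V v /\ hnorm (x - v) ^+ 2 <= inf D + r n ^+ 2.
  have [_ [v Vv <-] /ltW vlt] := inf_adherent (exprn_gt0 2 (r0 n)) Dlb.
  by exists v.
have /choice [u uP] := ex.
have hu n : hcar (u n) by apply: Vcar; have [] := uP n.
have hxu n : hcar (x - u n) by exact: hcarB.
have small n v : V v -> nrm (hdot (x - u n) v) <= r n * hnorm v.
  move=> Vv; have [Vu ule] := uP n.
  apply: (@hdot_le_of_almost_minimal _ _ (inf D)) => //; try exact: Vcar.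
    exact: ltW.
  move=> t; apply: ge_inf; first by case: Dlb.
  by exists (t *: v + u n); [exact: VP|rewrite opprD addrA addrAC].
have dist m n : hnorm (u m - u n) <= r m + r n.
  have Vw : V (u m - u n).
    by rewrite addrC -scaleN1r; apply: VP; [have [] := uP n|have [] := uP m].
  set w := u m - u n in Vw *; have hw := Vcar _ Vw.
  have [w0|w0] := eqVneq (hnorm w) 0.
    by rewrite w0 addr_ge0 ?ltW.
  have w_gt0 : 0 < hnorm w by rewrite lt_def w0 hnorm_ge0.
  rewrite -(ler_pM2r w_gt0) -expr2.
  have <- : nrm (hdot w w) = hnorm w ^+ 2.
    by rewrite -hnorm_sqr// nrm_real ger0_norm ?exprn_ge0 ?hnorm_ge0.
  have -> : hdot w w = hdot (x - u n) w - hdot (x - u m) w.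
    by rewrite -hdotBl//; congr hdot; rewrite opprB addrC subrKA.
  rewrite (le_trans (nrmD _ _))// nrmN mulrDl addrC lerD//; exact: small.
have rlim e : 0 < e -> exists N, forall n, (N <= n)%N -> r n < e.
  move=> e0; exists (Num.truncn e^-1) => n Nn; rewrite /r.
  rewrite invf_plt ?posrE//; apply: lt_le_trans (truncnS_gt _) _.
  by rewrite ler_nat.
have ucauchy : hcauchy u.
  move=> e e0; have [N NP] := rlim (e / 2) (divr_gt0 e0 (ltr0Sn _ _)).
  exists N => m n Nm Nn; apply: le_lt_trans (dist m n) _.
  have := NP m Nm; have := NP n Nn; lra.
have [p hp plim] := hcompl hu ucauchy.
exists p; split.
  split=> // e /plim [N /(_ N (leqnn N)) Ne]; exists (u N); first by have [] := uP N.
  by rewrite hnormB.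
move=> v Vv; apply: nrm_eq0; apply/eqP; rewrite eq_le nrm_ge0 andbT.
apply/ler_addgt0Pr => e e0; rewrite add0r.
have hv := Vcar _ Vv.
(* the summand [1] keeps the constant positive when [v] is zero *)
pose c := (hnorm v + 1) * 2.
have c0 : 0 < c by rewrite mulr_gt0// ltr_wpDl// hnorm_ge0.
have [N1 N1P] := rlim (e / c) (divr_gt0 e0 c0).
have [N2 N2P] := plim (e / c) (divr_gt0 e0 c0).
pose n := maxn N1 N2.
have := N1P n (leq_maxl _ _); have := N2P n (leq_maxr _ _).
have -> : hdot (x - p) v = hdot (x - u n) v + hdot (u n - p) v.
  by rewrite -hdotDl ?subrKA//; exact: hcarB.
move=> n2 n1.
apply: le_trans (nrmD _ _) _.
apply: (@le_trans _ _ (e / c * hnorm v + e / c * hnorm v)).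
  apply: lerD.
    by apply: le_trans (small n v Vv) _; rewrite ler_wpM2r ?hnorm_ge0// ltW.
  apply: le_trans (hcauchy_schwarz _ hv) _; first exact: hcarB.
  by rewrite ler_wpM2r ?hnorm_ge0// ltW.
have q0 : 0 < e / c by exact: divr_gt0.
rewrite -[leRHS](divfK (lt0r_neq0 c0)); set q := e / c in q0 *.
rewrite /c; lra.
Qed.

(** For [u] with [phi u != 0], the component [q] of [u] orthogonal to the kernel
    of [phi] represents [phi] up to the scalar [phi q / hdot q q], because
    [phi q *: x - phi x *: q] lies in the kernel for every [x]. *)
Theorem hriesz (phi : K -> R[i]) (C : R) :
  (forall (a : R[i]) x y, hcar x -> hcar y ->
     phi (a *: x + y) = a * phi x + phi y) ->
  (forall x, hcar x -> nrm (phi x) <= C * hnorm x) ->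
  exists2 y, hcar y & forall x, hcar x -> phi x = hdot x y.
Proof.
move=> philin phibd.
have phi0 : phi 0 = 0.
  apply: nrm_eq0; apply/eqP; rewrite eq_le nrm_ge0 andbT.
  have := phibd 0 car0; have -> : hnorm (0 : K) = 0.
    by rewrite /hnorm hdot0l// sqrtr0.
  by rewrite mulr0.
pose V := [set x : K | hcar x /\ phi x = 0].
have VS : hsubspace V.
  split=> [x []//|//|a x y [hx x0] [hy y0]]; split; first exact: carP.
  by rewrite philin// x0 y0 mulr0 addr0.
have [[u [hu phiu]]|nophi] := pselect (exists u, hcar u /\ phi u != 0); last first.
  exists 0 => // x hx; rewrite (hilbert_dotC hK)// hdot0l// rmorph0.
  by apply: contrapT => /eqP px; apply: nophi; exists x.
have [p [[hp pcl] orth]] := hprojection VS hu.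
have phip : phi p = 0.
  apply: (closure_vanish _ phibd (hsubspace_car VS) _ (conj hp pcl)).
    by move=> x y hx hy; have := philin 1 x y hx hy; rewrite scale1r mul1r.
  by move=> v [].
set q := u - p in orth; have hq : hcar q by exact: hcarB.
have phiq : phi q = phi u.
  by rewrite /q addrC -scaleN1r philin// phip mulr0 add0r.
have qq0 : hdot q q != 0.
  apply/eqP => /(hilbert_dot_eq0 hK hq) q0.
  by move: phiu; rewrite -phiq q0 phi0 eqxx.
exists (Num.conj (phi q / hdot q q) *: q); first exact: hcarZ.
move=> x hx; rewrite hdotZr// conjCK.
have /orth /(congr1 Num.conj) : V (- (phi x / phi q) *: q + x).
  split; first exact: carP.
  by rewrite philin// mulNr divfK ?addNr// phiq.
rewrite rmorph0 -(hilbert_dotC hK)//; last exact: carP.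
rewrite hilbert_dotP// => /eqP; rewrite mulNr addrC subr_eq0 => /eqP ->.
rewrite -phiq in phiu; have E (F : fieldType) (a b c : F) :
  b != 0 -> c != 0 -> a = b / c * (a / b * c) by move=> b0 c0; field; apply/andP.
exact: E.
Qed.

End HilbertSpace.

(** * Unconditional sums *)

Section UnconditionalSums.
Variables (R : realType) (I : choiceType).
Implicit Types (u : I -> R) (g h : I -> R[i]) (J : {fset I}).

Lemma esum_le_fset u (M : R) : (forall a, 0 <= u a) ->
  (forall J, \sum_(a <- J) u a <= M) ->
  (\esum_(a in [set: I]) (u a)%:E <= M%:E)%E.
Proof.
move=> u0 uM; apply: ge_ereal_sup => _ [X [finX _] <-].
by rewrite fsbig_finite// sumEFin lee_fin.
Qed.

Lemma fset_le_esum u J : ((\sum_(a <- J) u a)%:E <=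
  \esum_(a in [set: I]) (u a)%:E)%E.
Proof.
apply: esum_ge; exists [set` J]; first by split => //; exact: finite_fset.
by rewrite fsbig_finite ?set_fsetK ?sumEFin//; exact: finite_fset.
Qed.

Lemma esum_fin_num u : (forall a, 0 <= u a) ->
  (\esum_(a in [set: I]) (u a)%:E < +oo)%E ->
  exists S : R, \esum_(a in [set: I]) (u a)%:E = S%:E.
Proof.
move=> u0 uoo; exists (fine (\esum_(a in [set: I]) (u a)%:E)).
by rewrite fineK// ge0_fin_numE// esum_ge0// => a _; rewrite lee_fin.
Qed.

#[local] Existing Instance summability.totally_filter.

Definition usum g : R[i] := summability.sum (fun a => g a : R[i]^o).

Definition ucvg g (l : R[i]) := summability.partial_sum
  (fun a => g a : R[i]^o) @ summability.totally --> (l : R[i]^o).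

Lemma partial_sumE g J :
  summability.partial_sum (fun a => g a : R[i]^o) J = \sum_(a <- J) g a.
Proof. by rewrite big_seq_fsetE. Qed.

Lemma ucvgE g l : ucvg g l -> usum g = l.
Proof.
by apply: cvg_lim; exact: norm_hausdorff.
Qed.

Lemma ucvgP g l : (forall e : R, 0 < e -> exists J0, forall J,
    (J0 `<=` J)%fset -> nrm (l - \sum_(a <- J) g a) <= e) -> ucvg g l.
Proof.
move=> gl; apply/cvgrPdist_le => e e0.
have eE : (complex.Re e)%:C = e by rewrite RRe_real// gtr0_real.
have [|J0 J0P] := gl (complex.Re e); first by rewrite -ltcR eE.
exists J0 => // J /= /J0P; rewrite -lecR eE nrmE.
by rewrite partial_sumE.
Qed.

Lemma ucvg_eps g l : ucvg g l -> forall e : R, 0 < e -> exists J0, forall J,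
  (J0 `<=` J)%fset -> nrm (l - \sum_(a <- J) g a) <= e.
Proof.
move=> gl e e0; have e0' : 0 < e%:C by rewrite ltcR.
have /cvgrPdist_le /(_ _ e0') [J0 _ J0P] := gl.
by exists J0 => J /J0P /=; rewrite partial_sumE -lecR nrmE.
Qed.

Lemma ucvg_real u (S : R) : (forall a, 0 <= u a) ->
  \esum_(a in [set: I]) (u a)%:E = S%:E -> ucvg (fun a => (u a)%:C) S%:C.
Proof.
move=> u0 uS; apply: ucvgP => e e0.
have : ((S - e)%:E < \esum_(a in [set: I]) (u a)%:E)%E.
  by rewrite uS lte_fin gtrBl.
move=> /ereal_sup_gt [_ [X [finX _] <-]].
rewrite fsbig_finite// sumEFin lte_fin => SX.
exists (fset_set X) => J XJ.
rewrite -rmorph_sum -rmorphB nrm_real ler_norml.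
have JS := fset_le_esum u J; rewrite uS lee_fin in JS.
have : \sum_(a <- fset_set X) u a <= \sum_(a <- J) u a.
  rewrite [leRHS](big_fsetID _ [in fset_set X])/=.
  have -> : [fset x in J | x \in fset_set X]%fset = fset_set X.
    apply/fsetP => x; rewrite !inE/=; apply: andb_idl.
    exact: (fsubsetP XJ).
  by rewrite lerDl sumr_ge0.
by move=> XJS; apply/andP; split; lra.
Qed.

Lemma ucvgD g h l m : ucvg g l -> ucvg h m -> ucvg (fun a => g a + h a) (l + m).
Proof.
move=> gl hm; apply: ucvgP => e e0; have e2 : 0 < e / 2 by rewrite divr_gt0.
have [J0 J0P] := ucvg_eps gl e2; have [J1 J1P] := ucvg_eps hm e2.
exists (J0 `|` J1)%fset => J; rewrite fsubUset => /andP[/J0P gJ /J1P hJ].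
rewrite big_split opprD addrACA (le_trans (nrmD _ _))//.
by rewrite [leRHS](splitr e) lerD.
Qed.

Lemma ucvgZ c g l : ucvg g l -> ucvg (fun a => c * g a) (c * l).
Proof.
move=> gl; rewrite /ucvg.
have -> : summability.partial_sum (fun a => c * g a : R[i]^o) =
    (c : R[i]) \*: summability.partial_sum (fun a => g a : R[i]^o).
  by apply/funext => J; rewrite /= !partial_sumE -mulr_sumr.
exact: (@cvgZl_tmp _ (R[i]^o : normedModType R[i])).
Qed.

(** Absolute summability gives unconditional convergence by splitting into the
    positive and negative parts of the real and imaginary parts. *)
Lemma usum_cvg g : (\esum_(a in [set: I]) (nrm (g a))%:E < +oo)%E ->
  ucvg g (usum g).
Proof.
move=> goo.
have part u : (forall a, 0 <= u a) -> (forall a, u a <= nrm (g a)) ->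
    exists S : R, ucvg (fun a => (u a)%:C) S%:C.
  move=> u0 ug; have [|S /ucvg_real SP] := esum_fin_num u0; last by exists S; exact: SP.
  by apply: le_lt_trans goo; apply: le_esum => a _; rewrite lee_fin.
have max0 (r s : R) : 0 <= s -> `|r| <= s -> Num.max r 0 <= s.
  by move=> s0 rs; rewrite ge_max s0 (le_trans (ler_norm _)).
have maxD (r : R) : r = Num.max r 0 - Num.max (- r) 0.
  rewrite /Num.max; case: ltP => r0; case: ltP => r1; lra.
have Re_le (z : R[i]) : `|complex.Re z| <= nrm z by rewrite -lecR nrmE normc_ge_Re.
have Im_le (z : R[i]) : `|complex.Im z| <= nrm z.
  rewrite -[leLHS]normrN -ReiNIm (le_trans (Re_le _))// nrmM.
  have -> : nrm ('i%C : R[i]) = 1.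
    by rewrite /nrm normc_def /= expr0n expr1n add0r sqrtr1.
  by rewrite mulr1.
have [|a|r1 r1P] := part (fun a => Num.max (complex.Re (g a)) 0).
- by move=> a; rewrite le_max lexx orbT.
- by rewrite max0 ?nrm_ge0.
have [|a|r2 r2P] := part (fun a => Num.max (- complex.Re (g a)) 0).
- by move=> a; rewrite le_max lexx orbT.
- by rewrite max0 ?nrm_ge0// normrN.
have [|a|r3 r3P] := part (fun a => Num.max (complex.Im (g a)) 0).
- by move=> a; rewrite le_max lexx orbT.
- by rewrite max0 ?nrm_ge0.
have [|a|r4 r4P] := part (fun a => Num.max (- complex.Im (g a)) 0).
- by move=> a; rewrite le_max lexx orbT.
- by rewrite max0 ?nrm_ge0// normrN.
have := ucvgD (ucvgD r1P (@ucvgZ (-1) _ _ r2P))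
  (@ucvgZ 'i%C _ _ (ucvgD r3P (@ucvgZ (-1) _ _ r4P))).
under [X in ucvg X]funext => a.
  rewrite !mulN1r -!rmorphB /= -!maxD -complexE; over.
by move=> gl; rewrite (ucvgE gl).
Qed.

Lemma usumP c g h : (\esum_(a in [set: I]) (nrm (g a))%:E < +oo)%E ->
  (\esum_(a in [set: I]) (nrm (h a))%:E < +oo)%E ->
  usum (fun a => c * g a + h a) = c * usum g + usum h.
Proof.
by move=> /usum_cvg gl /usum_cvg hl; exact: ucvgE (ucvgD (@ucvgZ c _ _ gl) hl).
Qed.

Lemma usum_conj g : (\esum_(a in [set: I]) (nrm (g a))%:E < +oo)%E ->
  usum (fun a => Num.conj (g a)) = Num.conj (usum g).
Proof.
move=> /usum_cvg gl; apply: ucvgE; apply: ucvgP => e e0.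
have [J0 J0P] := ucvg_eps gl e0; exists J0 => J /J0P.
by rewrite -rmorph_sum -rmorphB /nrm norm_conjC.
Qed.

Lemma usum_real u (S : R) : (forall a, 0 <= u a) ->
  \esum_(a in [set: I]) (u a)%:E = S%:E -> usum (fun a => (u a)%:C) = S%:C.
Proof. by move=> u0 /(ucvg_real u0) /ucvgE. Qed.

Lemma usum1 g (b : I) : (forall a, a != b -> g a = 0) -> usum g = g b.
Proof.
move=> gb; apply: ucvgE; apply: ucvgP => e e0; exists [fset b]%fset => J.
rewrite fsub1set => bJ; rewrite (big_fsetD1 b)//= big_seq big1 => [|a].
  by rewrite addr0 subrr nrm0 ltW.
by rewrite !inE => /andP[/gb].
Qed.

End UnconditionalSums.

(** * Weighted square-summable families *)

Section FullSpace.
Variables (R : realType) (H : completeNormedModType R[i]).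
Variable dot : {dot H for (Num.conj : R[i] -> R[i])}.
Hypothesis dot_norm : forall x : H, dot x x = `|x| ^+ 2.

Lemma dot_normE (x : H) : dot x x = (nrm x ^+ 2)%:C.
Proof. by rewrite dot_norm rmorphXn /= nrmE. Qed.

Lemma dotPl (a : R[i]) (x y z : H) : dot (a *: x + y) z = a * dot x z + dot y z.
Proof. by rewrite linearDl linearZl_LR. Qed.

Lemma dot_conj (x y : H) : dot y x = Num.conj (dot x y).
Proof. by rewrite hermC expr0 mul1r. Qed.

Lemma full_prehilbert : prehilbert (full_hspace dot).
Proof.
split=> //= [a x y z _ _ _|x y _ _|x _].
- exact: dotPl.
- exact: dot_conj.
- by rewrite dot_norm => /eqP; rewrite expf_eq0 /= normr_eq0 => /eqP.
Qed.

Lemma full_hnorm (x : H) : hnorm (x : full_hspace dot) = nrm x.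
Proof. by rewrite /hnorm /= dot_normE /= sqrtr_sqr ger0_norm// nrm_ge0. Qed.

Lemma nrm_dot_le (x y : H) : nrm (dot x y) <= nrm x * nrm y.
Proof.
have := @hcauchy_schwarz _ _ full_prehilbert x y I I.
by rewrite !full_hnorm.
Qed.

End FullSpace.

Section WeightedL2.
Variables (R : realType) (H : completeNormedModType R[i]).
Variable dot : {dot H for (Num.conj : R[i] -> R[i])}.
Hypothesis dot_norm : forall x : H, dot x x = `|x| ^+ 2.
Variables (d : nat) (W : mindex d -> H -> H).
Hypothesis WP : forall a (c : R[i]) x y, W a (c *: x + y) = c *: W a x + W a y.
Hypothesis Wbij : forall a, bijective (W a).

Let K := weighted_l2 dot W.
Implicit Types (x y z : K) (J : {fset mindex d}).

Let W0 a : W a 0 = 0.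
Proof.
have := WP a 1 0 0; rewrite !scale1r addr0 => /eqP.
by rewrite -subr_eq0 opprD addNKr oppr_eq0 => /eqP.
Qed.

Let WZ a (c : R[i]) v : W a (c *: v) = c *: W a v.
Proof. by rewrite -[c *: v]addr0 WP W0 addr0. Qed.

Let WB a v w : W a (v - w) = W a v - W a w.
Proof. by rewrite addrC -scaleN1r WP scaleN1r addrC. Qed.

Lemma l2_carP x : hcar x <->
  exists M : R, forall J, \sum_(a <- J) nrm (W a (x a)) ^+ 2 <= M.
Proof.
split=> [xoo|[M xM]].
  have [|S xS] := esum_fin_num _ xoo; first by move=> a; rewrite exprn_ge0 ?nrm_ge0.
  by exists S => J; rewrite -lee_fin -xS; exact: fset_le_esum.
apply: (@le_lt_trans _ _ M%:E); last exact: ltry.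
by apply: esum_le_fset => // a; rewrite exprn_ge0 ?nrm_ge0.
Qed.

Lemma l2_dotE x y : hdot x y = usum (fun a => dot (W a (x a)) (W a (y a))).
Proof. by []. Qed.

Lemma l2_dot_summable x y : hcar x -> hcar y ->
  (\esum_(a in [set: mindex d]) (nrm (dot (W a (x a)) (W a (y a))))%:E < +oo)%E.
Proof.
move=> /l2_carP [M xM] /l2_carP [N yN].
apply: (@le_lt_trans _ _ (M + N)%:E); last exact: ltry.
apply: esum_le_fset => [a|J]; first exact: nrm_ge0.
apply: le_trans (lerD (xM J) (yN J)); rewrite -big_split ler_sum// => a _ /=.
apply: le_trans (nrm_dot_le dot_norm _ _) _.
have := nrm_ge0 (W a (x a)); have := nrm_ge0 (W a (y a)).
set s := nrm _; set t := nrm _ => s0 t0.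
have := sqr_ge0 (s - t); nra.
Qed.

Lemma l2_hnormE x : hcar x ->
  \esum_(a in [set: mindex d]) (nrm (W a (x a)) ^+ 2)%:E = (hnorm x ^+ 2)%:E /\
  hdot x x = (hnorm x ^+ 2)%:C.
Proof.
move=> xoo; have s0 a : 0 <= nrm (W a (x a)) ^+ 2 by rewrite exprn_ge0 ?nrm_ge0.
have [S xS] := esum_fin_num s0 xoo.
have dS : hdot x x = S%:C.
  rewrite l2_dotE -(usum_real s0 xS); congr usum.
  by apply/funext => a; rewrite dot_normE.
suff -> : hnorm x ^+ 2 = S by [].
rewrite /hnorm dS /= sqr_sqrtr// -lee_fin -xS.
by apply: esum_ge0 => a _; rewrite lee_fin.
Qed.

(** The squared norm of a family is the supremum of its finite partial sums;
    this lemma and the next reduce all norm estimates to finite sums. *)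
Lemma l2_sum_le x J : hcar x ->
  \sum_(a <- J) nrm (W a (x a)) ^+ 2 <= hnorm x ^+ 2.
Proof.
by move=> /l2_hnormE [xS _]; rewrite -lee_fin -xS; exact: fset_le_esum.
Qed.

Lemma l2_le x (M : R) : 0 <= M ->
  (forall J, \sum_(a <- J) nrm (W a (x a)) ^+ 2 <= M ^+ 2) ->
  hcar x /\ hnorm x <= M.
Proof.
move=> M0 xM; have hx : hcar x by apply/l2_carP; exists (M ^+ 2).
split=> //; rewrite -(@ler_pXn2r _ 2)// ?nnegrE ?sqrtr_ge0//.
have [xS _] := l2_hnormE hx; rewrite -lee_fin -xS.
by apply: esum_le_fset => // a; rewrite exprn_ge0 ?nrm_ge0.
Qed.

Lemma l2_coord_le x a : hcar x -> nrm (W a (x a)) <= hnorm x.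
Proof.
move=> /(@l2_sum_le x [fset a]%fset); rewrite big_seq_fset1.
by rewrite ler_pXn2r// nnegrE ?nrm_ge0 ?sqrtr_ge0.
Qed.

Lemma l2_prehilbert : prehilbert K.
Proof.
split=> [|c x y|c x y z hx hy hz|x y hx hy|x hx|x hx].
- apply/l2_carP; exists 0 => J; rewrite big1// => a _.
  by rewrite W0 nrm0 expr0n.
- move=> /l2_carP [M xM] /l2_carP [N yN].
  apply/l2_carP; exists (2 * nrm c ^+ 2 * M + 2 * N) => J.
  have c0 : 0 <= 2 * nrm c ^+ 2 by rewrite mulr_ge0 ?exprn_ge0 ?nrm_ge0.
  apply: le_trans (lerD (ler_wpM2l c0 (xM J)) (ler_wpM2l (ler0n _ 2) (yN J))).
  rewrite !mulr_sumr -big_split ler_sum// => a _ /=.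
  rewrite WP; have := nrmD (c *: W a (x a)) (W a (y a)); rewrite nrmZ.
  have := nrm_ge0 (c *: W a (x a) + W a (y a)).
  set s := nrm (_ + _); set t := nrm c * _; set u := nrm (W a (y a)) => s0 st.
  rewrite -mulrA -exprMn -/t.
  have := sqr_ge0 (t - u); nra.
- rewrite !l2_dotE -usumP; try exact: l2_dot_summable.
  by congr usum; apply/funext => a; rewrite WP dotPl.
- rewrite !l2_dotE -usum_conj; last exact: l2_dot_summable.
  by congr usum; apply/funext => a; rewrite -dot_conj.
- by have [_ ->] := l2_hnormE hx; rewrite ler0c exprn_ge0 ?sqrtr_ge0.
- have [_ ->] := l2_hnormE hx => /complexI /eqP; rewrite expf_eq0 /= => /eqP x0.
  apply/funext => a; apply: (bij_inj (Wbij a)); rewrite W0.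
  apply: nrm_eq0; apply/eqP; rewrite eq_le nrm_ge0 andbT -x0.
  exact: l2_coord_le.
Qed.

(** The limit is taken coordinatewise in [H] and pulled back through [W a].  For
    a fixed finite set [J] the partial sum of [u n - x] over [J] is compared
    with that of [u n - u m] for [m] so large that the coordinates of [u m] in
    [J] are close to their limits. *)
Lemma l2_complete : hcomplete K.
Proof.
move=> u hu ucauchy.
have hB m n : hcar (u m - u n) by apply: hcarB => //; exact: l2_prehilbert.
have lim a : exists v : H, forall e : R, 0 < e ->
    exists N, forall n, (N <= n)%N -> nrm (W a (u n a) - v) <= e.
  have : cauchy ((fun n => W a (u n a)) @ \oo).
    apply: cauchy_exP => e e0.
    have eE : (complex.Re e)%:C = e by rewrite RRe_real// gtr0_real.
    have [|N NP] := ucauchy (complex.Re e); first by rewrite -ltcR eE.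
    exists (W a (u N a)); exists N => // n /= Nn.
    rewrite -ball_normE /= -eE -nrmE ltcR -WB.
    exact: le_lt_trans (@l2_coord_le (u N - u n) a (hB N n)) (NP _ _ (leqnn N) Nn).
  move=> /cauchy_cvg /cvg_ex [v /cvgrPdist_le vP].
  exists v => e e0; have e0' : 0 < e%:C by rewrite ltcR.
  have [N _ NP] := vP _ e0'; exists N => n Nn; rewrite nrmB -lecR nrmE.
  exact: NP.
have /choice [v vP] := lim.
have /choice [Winv WK] : forall a, exists w, W a w = v a.
  by move=> a; have [g _ gK] := Wbij a; exists (g (v a)).
have fin J (e : R) : 0 < e -> exists N, forall n, (N <= n)%N ->
    \sum_(a <- J) nrm (W a (u n a) - v a) ^+ 2 <= e.
  elim: {J}(enum_fset J) e => [|b s IHs] e e0.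
    by exists 0%N => n _; rewrite big_nil ltW.
  have [N1 N1P] := IHs (e / 2) (divr_gt0 e0 (ltr0Sn _ _)).
  have [|N2 N2P] := vP b (Num.sqrt (e / 2)).
    by rewrite sqrtr_gt0 divr_gt0.
  exists (maxn N1 N2) => n; rewrite geq_max => /andP[/N1P n1 /N2P n2].
  rewrite big_cons [leRHS]splitr lerD//.
  have e2 : 0 < e / 2 by rewrite divr_gt0.
  rewrite -[leRHS](sqr_sqrtr (ltW e2)).
  by rewrite ler_pXn2r// nnegrE ?nrm_ge0 ?sqrtr_ge0.
have close (e : R) : 0 < e -> exists N, forall n, (N <= n)%N ->
    hcar (u n - (Winv : K)) /\ hnorm (u n - (Winv : K)) <= e.
  move=> e0; have e2 : 0 < e / 2 by rewrite divr_gt0.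
  have [N NP] := ucauchy _ e2; exists N => n Nn.
  apply: l2_le; rewrite ?ltW// => J.
  have [M MP] := fin J _ (exprn_gt0 2 e2).
  pose m := maxn N M.
  have un := NP n m Nn (leq_maxl _ _); have um := MP m (leq_maxr _ _).
  have := @l2_sum_le (u n - u m) J (hB n m).
  have : hnorm (u n - u m) ^+ 2 <= (e / 2) ^+ 2.
    by rewrite ler_pXn2r// ?nnegrE ?sqrtr_ge0// ltW.
  move=> unm2 /le_trans /(_ unm2) {}unm2.
  have : \sum_(a <- J) nrm (W a ((u n - (Winv : K)) a)) ^+ 2 <=
     \sum_(a <- J) (2 * nrm (W a ((u n - u m) a)) ^+ 2 +
                    2 * nrm (W a (u m a) - v a) ^+ 2).
    apply: ler_sum => a _.
    have -> : W a ((u n - (Winv : K)) a) =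
        W a ((u n - u m) a) + (W a (u m a) - v a).
      by rewrite !WB WK subrKA.
    have := nrmD (W a ((u n - u m) a)) (W a (u m a) - v a).
    have := nrm_ge0 (W a ((u n - u m) a) + (W a (u m a) - v a)).
    set s := nrm _; set t := nrm _; set q := nrm _ => s0 st.
    have := sqr_ge0 (t - q); nra.
  rewrite big_split /= -!mulr_sumr => /le_trans; apply.
  lra.
exists (Winv : K).
  have [N NP] := close 1 ltr01; have [h _] := NP N (leqnn N).
  rewrite -[X in hcar X](subKr (u N)).
  by apply: hcarB => //; exact: l2_prehilbert.
move=> e e0; have [|N NP] := close (e / 2); first by rewrite divr_gt0.
exists N => n /NP [_ /le_lt_trans]; apply; lra.
Qed.

Definition scale_coords (c : mindex d -> R[i]) x : K := fun a => c a *: x a.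

Lemma scale_coords_le (c : mindex d -> R[i]) (M : R) x : 0 <= M ->
  (forall a, x a != 0 -> nrm (c a) <= M) -> hcar x ->
  hcar (scale_coords c x) /\ hnorm (scale_coords c x) <= M * hnorm x.
Proof.
move=> M0 cM hx; apply: l2_le => [|J]; first by rewrite mulr_ge0 ?sqrtr_ge0.
rewrite exprMn; apply: le_trans (ler_wpM2l (exprn_ge0 2 M0) (l2_sum_le J hx)).
rewrite mulr_sumr ler_sum// => a _; rewrite /scale_coords WZ nrmZ exprMn.
have [->|xa] := eqVneq (x a) 0; first by rewrite W0 nrm0 expr0n !mulr0.
by rewrite ler_wpM2r ?exprn_ge0 ?nrm_ge0// ler_pXn2r ?nnegrE ?nrm_ge0// cM.
Qed.

Definition single (b : mindex d) (v : H) : K := fun a => if a == b then v else 0.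

Lemma single_dot b v y : hdot (single b v) y = dot (W b v) (W b (y b)).
Proof.
rewrite l2_dotE (@usum1 _ _ _ b) /single ?eqxx// => a /negPf ->.
by rewrite W0 -(scale0r 0) linearZl_LR mul0r.
Qed.

Lemma single_car b v : hcar (single b v).
Proof.
apply/l2_carP; exists (nrm (W b v) ^+ 2) => J.
have [bJ|bJ] := boolP (b \in J).
  rewrite (big_fsetD1 b)//= /single eqxx big_seq big1 ?addr0// => a.
  by rewrite !inE => /andP[/negPf -> _]; rewrite W0 nrm0 expr0n.
rewrite big_seq big1 ?exprn_ge0 ?nrm_ge0// => a aJ; rewrite /single.
by case: eqP => [ab|_]; [rewrite -ab aJ in bJ|rewrite W0 nrm0 expr0n].
Qed.

Lemma sum_singleE x J a :
  (\sum_(b <- J) single b (x b)) a = if a \in J then x a else 0.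
Proof.
rewrite fct_sumE; have [aJ|aJ] := boolP (a \in J).
  rewrite (big_fsetD1 a)//= /single eqxx big_seq big1 ?addr0// => b.
  by rewrite !inE eq_sym => /andP[/negPf -> _].
rewrite big_seq big1// => b bJ; rewrite /single.
by case: eqP => // ab; rewrite ab bJ in aJ.
Qed.

Lemma sum_single_car x J : hcar (\sum_(b <- J) single b (x b)).
Proof.
elim/big_ind: _ => [|y z hy hz|b _]; last exact: single_car.
  exact: hilbert0 l2_prehilbert.
by apply: hcarD => //; exact: l2_prehilbert.
Qed.

(** The squared norm is a supremum of finite sums: a finite set [J] whose partial
    sum exceeds [hnorm x ^+ 2 - e ^+ 2] leaves a tail of norm at most [e]. *)
Lemma l2_truncate x : hcar x ->
  hclosure (range (fun J => \sum_(b <- J) single b (x b))) x.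
Proof.
move=> hx; split=> // e' e0'; pose e := e' / 2.
have e0 : 0 < e by rewrite divr_gt0.
suff [J xJ] : exists J, hnorm (x - \sum_(b <- J) single b (x b)) <= e.
  exists (\sum_(b <- J) single b (x b)); first by exists J.
  by apply: le_lt_trans xJ _; rewrite /e; lra.
have [xS _] := l2_hnormE hx.
have : ((hnorm x ^+ 2 - e ^+ 2)%:E <
    \esum_(a in [set: mindex d]) (nrm (W a (x a)) ^+ 2)%:E)%E.
  by rewrite xS lte_fin gtrBl exprn_gt0.
move=> /ereal_sup_gt [_ [X [finX _] <-]].
rewrite fsbig_finite// sumEFin lte_fin => SX.
exists (fset_set X); set F := fset_set X in SX *.
have [|//] := @l2_le (x - \sum_(b <- F) single b (x b)) e (ltW e0) => J.
have -> : \sum_(a <- J) nrm (W a ((x - \sum_(b <- F) single b (x b)) a)) ^+ 2 =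
    \sum_(a <- (J `\` F)%fset) nrm (W a (x a)) ^+ 2.
  rewrite (big_fsetID _ [in F])/= big_seq big1 ?add0r; last first.
    move=> a; rewrite !inE /= => /andP[_ aF].
    by rewrite WB sum_singleE aF subrr nrm0 expr0n.
  have -> : [fset x0 in J | x0 \notin F]%fset = (J `\` F)%fset.
    by apply/fsetP => a; rewrite !inE /= andbC.
  rewrite big_seq [RHS]big_seq; apply: eq_bigr => a; rewrite !inE => /andP[aF _].
  by rewrite WB sum_singleE (negPf aF) W0 subr0.
have := l2_sum_le (F `|` J)%fset hx.
rewrite (big_fsetID _ [in F])/=.
have -> : [fset x0 in (F `|` J)%fset | x0 \in F]%fset = F.
  by apply/fsetP => a; rewrite !inE /=; case: (a \in F); rewrite ?andbF ?andbT.
have -> : [fset x0 in (F `|` J)%fset | x0 \notin F]%fset = (J `\` F)%fset.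
  by apply/fsetP => a; rewrite !inE /=; case: (a \in F); rewrite ?andbF ?andbT.
lra.
Qed.

(** Principle of extension by continuity: identities between bounded maps need
    only be checked on families with a single nonzero entry. *)
Lemma l2_ext_single (V : normedZmodType R[i]) (phi : K -> V) (C : R) :
  (forall x y, hcar x -> hcar y -> phi (x + y) = phi x + phi y) ->
  (forall x, hcar x -> nrm (phi x) <= C * hnorm x) ->
  (forall b v, phi (single b v) = 0) -> forall x, hcar x -> phi x = 0.
Proof.
move=> phiD phiC phi1 x hx.
have phi0 : phi 0 = 0.
  have h0 := hilbert0 l2_prehilbert.
  by have /eqP := phiD 0 0 h0 h0; rewrite addr0 -subr_eq0 opprD addNKr oppr_eq0 => /eqP.
have phiS J : phi (\sum_(b <- J) single b (x b)) = 0.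
  have : phi (\sum_(b <- J) single b (x b)) = 0 /\
      hcar (\sum_(b <- J) single b (x b)); last by case.
  elim/big_ind: _ => [|y z [y0 hy] [z0 hz]|b _].
  - by split=> //; exact: hilbert0 l2_prehilbert.
  - split; first by rewrite phiD// y0 z0 addr0.
    by apply: hcarD => //; exact: l2_prehilbert.
  - by split; [exact: phi1|exact: single_car].
apply: (closure_vanish l2_prehilbert phiD phiC _ _ (l2_truncate hx)).
  by move=> _ [J _ <-]; exact: sum_single_car.
by move=> _ [J _ <-]; exact: phiS.
Qed.

End WeightedL2.

(** * Moments of commuting weights *)

Section MultiIndexArithmetic.
Variable d : nat.
Implicit Types (a b : mindex d) (j : 'I_d).

Lemma mindexDE a b j : (a + b) j = (a j + b j)%N.
Proof. by rewrite ffunE. Qed.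

Lemma epsE j (i : 'I_d) : eps j i = (i == j).
Proof. by rewrite ffunE. Qed.

Lemma msubE a b j : msub a b j = (a j - b j)%N.
Proof. by rewrite ffunE. Qed.

Lemma eps_mulE j k (i : 'I_d) : (eps j *+ k) i = if i == j then k else 0%N.
Proof.
elim: k => [|k IHk]; first by rewrite mulr0n ffunE; case: eqP.
by rewrite mulrS mindexDE IHk epsE; case: eqP.
Qed.

Lemma msubDK a j : msub (a + eps j) (eps j) = a.
Proof. by apply/ffunP => i; rewrite msubE mindexDE addnK. Qed.

Lemma msubK a j : (0 < a j)%N -> msub a (eps j) + eps j = a.
Proof.
move=> aj; apply/ffunP => i; rewrite mindexDE msubE epsE.
by case: eqP => [->|]; rewrite ?subnK// subn0 addn0.
Qed.

Lemma msubDC a i j : (0 < a i)%N ->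
  msub (a + eps j) (eps i) = msub a (eps i) + eps j.
Proof.
move=> ai; apply/ffunP => l; rewrite !(msubE, mindexDE) !epsE.
by case: (l =P i) => [->|_]; rewrite ?subn0// addnBAC.
Qed.

(** The multi-index reached after the first [m] coordinates have been brought
    down to zero; the [j]-th factor of a moment starts from [tail j a]. *)
Definition tail (m : nat) a : mindex d :=
  [ffun i : 'I_d => if (i < m)%N then 0%N else a i].

Lemma tail_at m a (i : 'I_d) : tail m a i = if (i < m)%N then 0%N else a i.
Proof. by rewrite ffunE. Qed.

Lemma tailE a j : msub a (\sum_(l < d | (l < j)%N) eps l *+ a l) = tail j a.
Proof.
apply/ffunP => i; rewrite msubE tail_at sum_ffunE.
have [ij|ij] := ltnP i j.
  rewrite (bigD1 i)//= eps_mulE eqxx big1 ?addr0 ?subnn// => l /andP[_ li].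
  by rewrite eps_mulE eq_sym (negPf li).
rewrite big1 ?subn0// => l lj; rewrite eps_mulE; case: eqP => // il.
by move: lj; rewrite -il ltnNge ij.
Qed.

Lemma tail_eps a j m : (m <= j)%N -> tail m (a + eps j) = tail m a + eps j.
Proof.
move=> mj; apply/ffunP => i; rewrite !(tail_at, mindexDE) epsE.
by case: ltnP => // im; case: eqP => // ij; move: im; rewrite ij ltnNge mj.
Qed.

Lemma tail_eps_lt a j m : (j < m)%N -> tail m (a + eps j) = tail m a.
Proof.
move=> jm; apply/ffunP => i; rewrite !(tail_at, mindexDE) epsE.
by case: ltnP => // im; case: eqP => [ij|_]; [move: im; rewrite ij leqNgt jm|rewrite addn0].
Qed.

Lemma tail_succ a j : msub (tail j a) (eps j *+ a j) = tail j.+1 a.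
Proof.
apply/ffunP => i; rewrite msubE eps_mulE !tail_at ltnS.
have [ij|ij|ij] := ltngtP i j; first by rewrite sub0n.
  by case: eqP => [E|_]; [move: ij; rewrite E ltnn|rewrite subn0].
by rewrite (ord_inj ij) eqxx subnn.
Qed.

End MultiIndexArithmetic.

Section Moments.
Variables (R : realType) (H : completeNormedModType R[i]) (d : nat).
Variable A : 'I_d -> mindex d -> {linear H -> H}.

Lemma partial_moment0 j a : partial_moment A j a 0 = id.
Proof. by rewrite /partial_moment big_geq. Qed.

Lemma partial_momentS j a k : partial_moment A j a k.+1 =
  A j (msub a (eps j)) \o partial_moment A j (msub a (eps j)) k.
Proof.
rewrite /partial_moment big_nat_recl// mulr1n; congr (_ \o _).
apply: eq_big_nat => i _; congr (fun b => A j b : H -> H).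
by apply/ffunP => l; rewrite !msubE mulrS mindexDE subnDA.
Qed.

Lemma moment_linear a (c : R[i]) x y :
  moment A a (c *: x + y) = c *: moment A a x + moment A a y.
Proof.
move: c x y; rewrite /moment.
elim/big_ind: _ => // [f g fP gP c x y|j _]; first by rewrite /= gP fP.
rewrite /partial_moment.
elim/big_ind: _ => // [f g fP gP c x y|i _ c x y]; first by rewrite /= gP fP.
exact: linearP.
Qed.

Lemma moment_zero a : moment A a 0 = 0.
Proof.
have := moment_linear a 1 0 0; rewrite !scale1r addr0 => /eqP.
by rewrite -subr_eq0 opprD addNKr oppr_eq0 => /eqP.
Qed.

Lemma moment0 x : moment A 0 x = x.
Proof.
rewrite /moment; suff : \big[(fun f g => f \o g)/id]_(j < d)
  partial_moment A j (msub 0 (\sum_(l < d | (l < j)%N) eps l *+ (0%R : mindex d) l))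
    ((0%R : mindex d) j) = id by move=> ->.
elim/big_ind: _ => // [f g -> ->//|j _].
by rewrite ffunE partial_moment0.
Qed.

Hypothesis A_inv : forall j a, invertible_operator (A j a).

Lemma moment_bij a : bijective (moment A a).
Proof.
have id_bij : bijective (@id H) by exists id.
rewrite /moment; elim/big_ind: _ => // [f g fP gP|j _]; first exact: bij_comp.
rewrite /partial_moment; elim/big_ind: _ => // [f g fP gP|i _]; first exact: bij_comp.
by have [_ [g [_ fK gK]]] := A_inv j (msub a (\sum_(l < d | (l < j)%N) eps l *+ a l));
  have [_ [h [_ hK hK']]] := A_inv j (msub (msub a (\sum_(l < d | (l < j)%N) eps l *+ a l)) (eps j *+ i));
  exists h.
Qed.

Hypothesis A_comm : forall a i j,
  A i (a + eps j) \o A j a = A j (a + eps i) \o A i a :> (H -> H).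

(** Commuting [A j] through a run of steps in direction [i] shifts the whole run
    by [eps j]. *)
Lemma A_partial_moment i j (a : mindex d) k x : (k <= a i)%N ->
  A j a (partial_moment A i a k x) =
  partial_moment A i (a + eps j) k (A j (msub a (eps i *+ k)) x).
Proof.
elim: k a => [|k IHk] a ka.
  rewrite !partial_moment0; congr (A j _ x).
  by apply/ffunP => l; rewrite msubE ffunE subn0.
rewrite !partial_momentS /=.
have ai : (0 < a i)%N by exact: leq_trans ka.
rewrite msubDC//; set b := msub a (eps i).
have Ab y : A j a (A i b y) = A i (b + eps j) (A j b y).
  have := congr1 (fun f => f y) (A_comm b j i).
  by rewrite /= msubK.
rewrite Ab IHk; last by rewrite msubE epsE eqxx; lia.
have -> // : msub b (eps i *+ k) = msub a (eps i *+ k.+1).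
by apply/ffunP => l; rewrite !msubE mulrS mindexDE subnDA.
Qed.

(** [A j a] is pushed through the runs in directions [i < j], each time shifting
    the run by [eps j], until it meets the run in direction [j], which it
    lengthens by one; the later runs start below [j] and do not change. *)
Lemma moment_eps j (a : mindex d) x : moment A (a + eps j) x = A j a (moment A a x).
Proof.
rewrite /moment; under eq_bigr => i _ do rewrite tailE.
under [in RHS]eq_bigr => i _ do rewrite tailE.
(* the product is rewritten over a range of naturals, so that it can be cut *)
pose F (b : mindex d) (i : nat) : H -> H := if insub i is Some i' then
  partial_moment A i' (tail i' b) (b i') else id.
have FE b (i : 'I_d) : F b i = partial_moment A i (tail i b) (b i).
  by rewrite /F valK.
have E b : \big[(fun f g => f \o g)/id]_(i < d)
      partial_moment A i (tail i b) (b i) =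
    \big[(fun f g => f \o g)/id]_(0 <= i < d) F b i.
  by rewrite big_mkord; apply: eq_bigr => i _; rewrite FE.
rewrite !E.
have tail0 b : b = tail 0 b by apply/ffunP => i; rewrite tail_at.
rewrite {2}[a]tail0.
have claim k : forall m, (m + k = j)%N ->
    A j (tail m a) ((\big[(fun f g => f \o g)/id]_(m <= i < d) F a i) x) =
    (\big[(fun f g => f \o g)/id]_(m <= i < d) F (a + eps j) i) x.
  elim: k => [|k IHk] m mj.
    have {mj}-> : m = j by lia.
    rewrite [in LHS]big_ltn// [in RHS]big_ltn//= !FE.
    rewrite tail_eps// mindexDE epsE eqxx addn1 partial_momentS msubDK /=.
    congr (A j _ (partial_moment A j _ _ (_ x))).
    apply: eq_big_nat => i /andP[ji lid]; rewrite !(FE _ (Ordinal lid)).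
    rewrite tail_eps_lt// mindexDE epsE -val_eqE /=.
    by rewrite gtn_eqF// addn0.
  have md : (m < d)%N by apply: leq_ltn_trans (ltn_ord j); lia.
  rewrite [in LHS]big_ltn// [in RHS]big_ltn//=.
  rewrite !(FE _ (Ordinal md)).
  have mj' : (m < j)%N by lia.
  rewrite A_partial_moment; last by rewrite tail_at ltnn.
  rewrite tail_eps ?(ltnW mj')// mindexDE epsE -val_eqE /= (ltn_eqF mj') addn0.
  congr (partial_moment A _ _ _ _).
  rewrite -IHk; last by lia.
  by rewrite -[m.+1]/((Ordinal md).+1) -tail_succ.
by rewrite -(claim j 0%N).
Qed.

End Moments.

(** * Point evaluations on power series *)

Section PointEvaluations.
Variables (R : realType) (H : completeNormedModType R[i]).
Variable dot : {dot H for (Num.conj : R[i] -> R[i])}.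
Hypothesis dot_norm : forall x : H, dot x x = `|x| ^+ 2.
Variables (d : nat) (A : 'I_d -> mindex d -> {linear H -> H}).
Hypothesis A_inv : forall j a, invertible_operator (A j a).

Let K := H2 dot A.
Local Notation eval_at := (@Defs.eval R H dot d A).
Implicit Types (w : 'rV[R[i]^o]_d) (f g : K) (a b : mindex d) (x : H).

Lemma H2_prehilbert : prehilbert K.
Proof.
apply: l2_prehilbert => // [a c x y|a]; first exact: moment_linear.
exact: moment_bij.
Qed.

Lemma H2_complete : hcomplete K.
Proof.
apply: l2_complete => // [a c x y|a]; first exact: moment_linear.
exact: moment_bij.
Qed.

Let K0 := H2_prehilbert.
Let BP a (c : R[i]) (x y : H) := moment_linear A a c x y.
Let Bbij a := moment_bij A_inv a.

Definition mono_series b x : K := @single R H dot d (moment A) b x.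

Local Notation mono := mono_series.

Lemma mono_car b x : hcar (mono b x).
Proof. exact: (single_car dot BP). Qed.

Lemma H2_scale_le (c : mindex d -> R[i]) (M : R) f : 0 <= M ->
  (forall a, f a != 0 -> nrm (c a) <= M) -> hcar f ->
  hcar (scale_coords (dot := dot) (W := moment A) c f) /\
  hnorm (scale_coords (dot := dot) (W := moment A) c f) <= M * hnorm f.
Proof. by apply: scale_coords_le => //; exact: BP. Qed.

Lemma H2_ext (V : normedZmodType R[i]) (phi : K -> V) (C : R) :
  (forall f g, hcar f -> hcar g -> phi (f + g) = phi f + phi g) ->
  (forall f, hcar f -> nrm (phi f) <= C * hnorm f) ->
  (forall b v, phi (mono b v) = 0) -> forall f, hcar f -> phi f = 0.
Proof.
by move=> phiD phiC phi1; apply: (l2_ext_single dot_norm BP Bbij phiD phiC phi1).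
Qed.

Lemma monomial_eps w b j : monomial w (b + eps j) = (w 0 j : R[i]) * monomial w b.
Proof.
rewrite /monomial (bigD1 j)//= [in RHS](bigD1 j)//= mulrA.
rewrite mindexDE epsE eqxx addn1 exprS; congr (_ * _).
by apply: eq_bigr => i ij; rewrite mindexDE epsE (negPf ij) addn0.
Qed.

Lemma poly_evalE w f (F : {fset mindex d}) : (forall a, a \notin F -> f a = 0) ->
  poly_eval w f = \sum_(a <- F) monomial w a *: f a.
Proof.
move=> fF; rewrite /poly_eval -(fsbig_widen [set` F] setT)//=; last first.
  by move=> a [_ /= /negP aF]; rewrite fF ?scaler0.
by rewrite fsbig_finite ?set_fsetK//; exact: finite_fset.
Qed.

Lemma mono_polynomial b x : is_polynomial (mono b x).
Proof.
apply: (@sub_finite_set _ _ [set b]); last exact: finite_set1.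
by move=> a /=; rewrite /mono_series /single; have [->|_] := eqVneq a b; rewrite /= ?eqxx.
Qed.

Lemma poly_eval_mono w b x : poly_eval w (mono b x) = monomial w b *: x.
Proof.
rewrite (@poly_evalE w _ [fset b]%fset); last first.
  by move=> a; rewrite inE /mono_series /single => /negPf ->.
by rewrite big_seq_fset1 /mono_series /single eqxx.
Qed.

Lemma hlinearD (E : K -> full_hspace dot) f g : hlinear E -> hcar f -> hcar g ->
  E (f + g) = E f + E g.
Proof. by move=> EP hf hg; have := EP 1 f g hf hg; rewrite !scale1r. Qed.

Lemma hlinear0 (E : K -> full_hspace dot) : hlinear E -> E 0 = 0.
Proof.
move=> EP; have h0 := hilbert0 K0; have /eqP := hlinearD EP h0 h0.
by rewrite addr0 -subr_eq0 opprD addNKr oppr_eq0 => /eqP.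
Qed.

Lemma hlinearZ (E : K -> full_hspace dot) (c : R[i]) f : hlinear E -> hcar f ->
  E (c *: f) = c *: E f.
Proof.
move=> EP hf; have := EP c f 0 hf (hilbert0 K0).
by rewrite !addr0 hlinear0// addr0.
Qed.

Lemma hlinearB (E : K -> full_hspace dot) f g : hlinear E -> hcar f -> hcar g ->
  E (f - g) = E f - E g.
Proof.
move=> EP hf hg; have := EP (-1) g f hg hf.
by rewrite !scaleN1r addrC => ->; rewrite addrC.
Qed.

(** Rescale a vector [f] to norm [r / 2], where [r] is the radius given by
    continuity at zero for the error one. *)
Lemma hcontinuous_bounded (E : K -> full_hspace dot) : hlinear E ->
  hcontinuous E -> exists C : R, forall f, hcar f -> nrm (E f : H) <= C * hnorm f.
Proof.
move=> EP Ec; have [r r0 rP] := Ec 0 (hilbert0 K0) 1 ltr01.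
exists (2 / r) => f hf; have [f0|f0] := eqVneq (hnorm f) 0.
  by rewrite (hnorm_eq0 K0 hf f0) hlinear0// nrm0 mulr_ge0 ?divr_ge0 ?sqrtr_ge0// ltW.
have fgt0 : 0 < hnorm f by rewrite lt_def f0 sqrtr_ge0.
pose c : R := r / 2 / hnorm f; have c0 : 0 < c by rewrite !divr_gt0.
have := rP (c%:C *: f) (hcarZ K0 _ hf).
rewrite !hlinear0// !subr0 hlinearZ// hnormZ// (full_hnorm dot_norm).
rewrite nrmZ nrm_real gtr0_norm// => /(_ _)/ltW Hc.
have {Hc} : c * nrm (E f : H) <= 1.
  by apply: Hc; rewrite /c divfK//; lra.
rewrite mulrC -ler_pdivlMr// div1r => /le_trans; apply.
by rewrite /c !invf_div mulrC.
Qed.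

Lemma bounded_hcontinuous (E : K -> full_hspace dot) (C : R) : hlinear E ->
  (forall f, hcar f -> nrm (E f : H) <= C * hnorm f) -> hcontinuous E.
Proof.
move=> EP EC f hf e e0; have C0 : 0 < `|C| + 1 by rewrite ltr_wpDl.
exists (e / (`|C| + 1)); first exact: divr_gt0.
move=> g hg; rewrite ltr_pdivlMr// => gf; rewrite -hlinearB// (full_hnorm dot_norm).
apply: le_lt_trans (EC _ (hcarB K0 hg hf)) _; apply: le_lt_trans gf.
by rewrite mulrC ler_wpM2l ?sqrtr_ge0// (le_trans (ler_norm C))// lerDl.
Qed.

(** Polynomials are finite sums of monomial series, so only the values on those
    have to be checked. *)
Lemma is_evalI w (E : K -> full_hspace dot) (C : R) : hlinear E ->
  (forall f, hcar f -> nrm (E f : H) <= C * hnorm f) ->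
  (forall b x, E (mono b x) = monomial w b *: x) -> is_eval w E.
Proof.
move=> EP EC E1; split=> //; first exact: bounded_hcontinuous EC.
move=> p pfin; pose F := fset_set [set a | p a != 0].
have pF a : a \notin F -> p a = 0.
  by rewrite /F in_fset_set// notin_setE /= => /negP; rewrite negbK => /eqP.
have pE : p = \sum_(b <- F) mono b (p b).
  apply/funext => a; rewrite (sum_singleE (dot := dot) (W := moment A)).
  by case: ifPn => // /pF.
rewrite (poly_evalE w pF) [in LHS]pE.
suff : E (\sum_(b <- F) mono b (p b)) = \sum_(b <- F) monomial w b *: p b /\
  hcar (\sum_(b <- F) mono b (p b)) by case.
elim: (enum_fset F) => [|b s [IHs hs]]; first by rewrite !big_nil hlinear0//; split=> //; exact: hilbert0 K0.
rewrite !big_cons hlinearD// ?IHs ?E1; last exact: mono_car.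
by split=> //; apply: hcarD => //; exact: mono_car.
Qed.

Lemma is_eval_bounded w (E : K -> full_hspace dot) : is_eval w E ->
  exists C : R, forall f, hcar f -> nrm (E f : H) <= C * hnorm f.
Proof. by case=> EP Ec _; exact: hcontinuous_bounded. Qed.

Lemma is_eval_unique w (E E' : K -> full_hspace dot) : is_eval w E ->
  is_eval w E' -> forall f, hcar f -> E f = E' f.
Proof.
move=> hE hE' f hf; apply/eqP; rewrite -subr_eq0; apply/eqP.
have [C EC] := is_eval_bounded hE; have [C' EC'] := is_eval_bounded hE'.
have [EP _ E1] := hE; have [EP' _ E1'] := hE'.
pose phi g : H := E g - E' g; rewrite -/(phi f).
apply: (@H2_ext _ phi (C + C')) => // [g h hg hh|g hg|b x].
- by rewrite /phi !hlinearD// opprD addrACA.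
- by rewrite (le_trans (nrmD _ _))// nrmN mulrDl lerD// ?EC ?EC'.
- by rewrite /phi E1 ?E1' ?subrr//; exact: mono_polynomial.
Qed.

Lemma evalP w : bpe dot A w -> is_eval w (eval_at w).
Proof. by move=> wP; exact: (@xgetPex _ (fun _ => 0) [set E | is_eval w E]). Qed.

Lemma eval_unique w (E : K -> full_hspace dot) : is_eval w E ->
  forall f, hcar f -> eval_at w f = E f.
Proof.
move=> wE; apply: (is_eval_unique _ wE); apply: evalP; by exists E.
Qed.

Lemma eval_mono w b x : bpe dot A w -> eval_at w (mono b x) = monomial w b *: x.
Proof.
move=> /evalP [_ _ ->]; first exact: poly_eval_mono.
exact: mono_polynomial.
Qed.

Section OnePoint.
Variable w : 'rV[R[i]^o]_d.
Hypothesis wP : bpe dot A w.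

Lemma eval_linear : hlinear (eval_at w).
Proof. by have [] := evalP wP. Qed.

Lemma eval_bounded :
  exists C : R, forall f, hcar f -> nrm (eval_at w f : H) <= C * hnorm f.
Proof. exact: is_eval_bounded (evalP wP). Qed.

(** Riesz representation of [f |-> dot (eval w f) x], which is bounded by the
    Cauchy-Schwarz inequality in [H]. *)
Lemma eval_adjointP x : hcar (hadjoint (eval_at w) x) /\
  forall f, hcar f ->
    dot (eval_at w f) x = hdot f (hadjoint (eval_at w) x).
Proof.
have [C EC] := eval_bounded.
have [||g hg gP] := @hriesz _ _ K0 H2_complete
    (fun f => dot (eval_at w f) x) (C * nrm x).
- by move=> c f g hf hg; rewrite eval_linear// dotPl.
- move=> f hf; apply: le_trans (nrm_dot_le dot_norm _ _) _.
  by rewrite mulrAC ler_wpM2r ?nrm_ge0 ?EC.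
- apply: (@xgetPex _ 0 [set g : K | hcar g /\ forall f : K, hcar f ->
      dot (eval_at w f) x = hdot f g]).
  by exists g.
Qed.

Lemma eval_closed (V : set K) : (forall g, V g -> hcar g /\ eval_at w g = 0) ->
  forall f, hclosure V f -> eval_at w f = 0.
Proof.
move=> V0 f; have [C EC] := eval_bounded.
apply: (closure_vanish K0 (phi := eval_at w : K -> H) _ EC) => [x y hx hy|g|g].
- by apply: hlinearD => //; exact: eval_linear.
- by move=> /V0 [].
- by move=> /V0 [].
Qed.

End OnePoint.

Lemma restrictionP (c : R[i]) f g : hcar f -> hcar g ->
  restriction (c *: f + g) = c *: restriction f + restriction g.
Proof.
by move=> hf hg; apply/funext => w; rewrite /restriction eval_linear//; exact: set_valP.
Qed.

Lemma restrictionB f g : hcar f -> hcar g ->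
  restriction (f - g) = restriction f - restriction g.
Proof.
by move=> hf hg; rewrite addrC -scaleN1r restrictionP// scaleN1r addrC.
Qed.

Definition vanishing : set K := [set f | hcar f /\ restriction f = 0].

Lemma restriction0P f : restriction f = 0 <->
  forall w, bpe dot A w -> eval_at w f = 0.
Proof.
split=> [f0 w wP|f0]; first by have := congr1 (@^~ (SigSub (mem_set wP))) f0.
by apply/funext => w; apply: f0; exact: set_valP.
Qed.

Lemma vanishing_subspace : hsubspace vanishing.
Proof.
split=> [f []//||c f g [hf f0] [hg g0]].
  split; first exact: hilbert0 K0.
  by apply/restriction0P => w /eval_linear /hlinear0.
by split; [exact: hilbertP K0 _ _ _ hf hg|rewrite restrictionP// f0 g0 scaler0 addr0].
Qed.

Lemma vanishing_closed : hclosure vanishing `<=` vanishing.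
Proof.
move=> f fN; split; first by have [] := fN.
apply/restriction0P => w wP; apply: (eval_closed wP) fN => g [hg g0].
by split=> //; move/restriction0P: g0; exact.
Qed.

Definition orth_vanishing f := forall g, hcar g -> restriction g = 0 -> hdot f g = 0.

(** Subtract from [f] its projection onto the vanishing series, which is again
    vanishing since these form a closed subspace. *)
Lemma orth_lift_exists f : hcar f -> exists g,
  [/\ hcar g, restriction g = restriction f & orth_vanishing g].
Proof.
move=> hf; have [p [/vanishing_closed [hp p0] porth]] :=
  hprojection K0 H2_complete vanishing_subspace hf.
exists (f - p); split; first exact: (hcarB K0 hf hp).
  by rewrite restrictionB// p0 subr0.
by move=> g hg g0; apply: porth.
Qed.

Lemma orth_lift_unique f g : hcar f -> hcar g -> orth_vanishing f ->
  orth_vanishing g -> restriction f = restriction g -> f = g.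
Proof.
move=> hf hg of_ og fg; apply/eqP; rewrite -subr_eq0; apply/eqP.
have hfg := hcarB K0 hf hg.
have fg0 : restriction (f - g) = 0 by rewrite restrictionB// fg subrr.
by apply: (hilbert_dot_eq0 K0) => //; rewrite hdotBl// of_// og// subrr.
Qed.

Lemma min_liftP (F : Hkappa dot A) : hcar F ->
  [/\ hcar (min_lift F), restriction (min_lift F) = F &
      orth_vanishing (min_lift F)].
Proof.
move=> [f hf <-]; have := orth_lift_exists hf.
exact: (@xgetPex _ 0 [set g : K | [/\ hcar g, restriction g = restriction f &
  orth_vanishing g]]).
Qed.

Lemma min_lift_restriction f : hcar f -> orth_vanishing f ->
  min_lift (restriction f) = f.
Proof.
move=> hf of_; have [|h1 h2 h3] := @min_liftP (restriction f); first by exists f.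
exact: orth_lift_unique.
Qed.

(** [f] and the minimal lift of its restriction differ by a vanishing series,
    which the pairing with [g] does not see.  Thus only one of the two series
    has to be a minimal lift. *)
Lemma Hkappa_dot f g : hcar f -> hcar g -> orth_vanishing g ->
  hdot (restriction f : Hkappa dot A) (restriction g) = hdot f g.
Proof.
move=> hf hg og; have [|h1 h2 h3] := @min_liftP (restriction f); first by exists f.
rewrite /= (min_lift_restriction hg og).
set u := min_lift _ in h1 h2 h3 *; apply/eqP; rewrite -subr_eq0 -(hdotBl K0)//.
have huf := hcarB K0 h1 hf.
rewrite (hilbert_dotC K0)// og ?rmorph0//.
by rewrite restrictionB// h2 subrr.
Qed.

End PointEvaluations.

(** * Adjoints of the coordinate multiplications *)

Section Shift.
Variables (R : realType) (H : completeNormedModType R[i]).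
Variable dot : {dot H for (Num.conj : R[i] -> R[i])}.
Hypothesis dot_norm : forall x : H, dot x x = `|x| ^+ 2.
Variables (d : nat) (A : 'I_d -> mindex d -> {linear H -> H}).
Hypothesis A_inv : forall j a, invertible_operator (A j a).
Hypothesis A_comm : commuting_multishift A.

Let K := H2 dot A.
Local Notation eval_at := (@Defs.eval R H dot d A).
Local Notation mono := (@mono_series R H dot d A).
Implicit Types (w : 'rV[R[i]^o]_d) (f g : K) (a b : mindex d) (x : H).
Let K0 : prehilbert K := H2_prehilbert dot_norm A_inv.
Let Kc : hcomplete K := H2_complete dot_norm A_inv.

(** The supremum over the unit ball bounds [A j a x] for general [x] by
    homogeneity. *)
Lemma weight_bounded j :
  exists2 C : R, 0 <= C & forall a x, nrm (A j a x) <= C * nrm x.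
Proof.
have [/(_ j) Aj _] := A_comm.
set S := ereal_sup _ in Aj.
have unit_le a x : nrm x <= 1 -> ((nrm (A j a x))%:E <= S)%E.
  move=> x1; apply: (@le_trans _ _ (opnorm (A j a))).
    by apply: ereal_sup_ubound; exists x => //=; rewrite -nrmE lecR.
  by apply: ereal_sup_ubound; exists a.
have S0 : (0 <= S)%E.
  by have := unit_le 0 0; rewrite linear0 nrm0; apply.
have SE : (fine S)%:E = S by rewrite fineK// ge0_fin_numE.
exists (fine S); first by rewrite -lee_fin SE.
move=> a x; have [x0|x0] := eqVneq (nrm x) 0.
  by rewrite x0 mulr0 (nrm_eq0 x0) linear0 nrm0.
have xgt0 : 0 < nrm x by rewrite lt_def x0 nrm_ge0.
rewrite -ler_pdivrMr// -lee_fin SE.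
have -> : nrm (A j a x) / nrm x = nrm (A j a ((nrm x)^-1%:C *: x)).
  by rewrite linearZ nrmZ nrm_real ger0_norm ?invr_ge0 ?nrm_ge0// mulrC.
by apply: unit_le; rewrite nrmZ nrm_real ger0_norm ?invr_ge0 ?nrm_ge0// mulVf.
Qed.

(** Multiplication by the coordinate function [z_j], on power series. *)
Definition zmul j f : K := fun a => if a j == 0%N then 0 else f (msub a (eps j)).

Lemma zmulP j (c : R[i]) f g : zmul j (c *: f + g) = c *: zmul j f + zmul j g.
Proof.
apply/funext => a; rewrite /zmul !fctE.
by case: eqP => // _; rewrite scaler0 addr0.
Qed.

Lemma zmulD j f g : zmul j (f + g) = zmul j f + zmul j g.
Proof. by have := zmulP j 1 f g; rewrite !scale1r. Qed.

Lemma zmul_mono j b x : zmul j (mono b x) = mono (b + eps j) x.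
Proof.
apply/funext => a; rewrite /zmul /mono_series /single.
have [aj|aj] := eqVneq (a j) 0%N.
  case: eqP => // ab; move: aj; rewrite ab mindexDE epsE eqxx; lia.
rewrite -lt0n in aj; congr (if _ then _ else _).
apply/eqP/eqP => [<-|->]; [by rewrite msubK|by rewrite msubDK].
Qed.

(** By the recursion for moments the coefficient [f a] reappears in [zmul j f]
    weighted by [A j a] applied to [moment A a (f a)], so the uniform bound on
    the weights carries over. *)
Lemma zmul_bounded j : exists2 C : R, 0 <= C & forall f, hcar f ->
  hcar (zmul j f) /\ hnorm (zmul j f) <= C * hnorm f.
Proof.
have [C C0 AC] := weight_bounded j; exists C => // f hf.
pose s (g : K) a := nrm (moment A a (g a)) ^+ 2.
have s0 g a : 0 <= s g a by rewrite exprn_ge0 ?nrm_ge0.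
apply: (l2_le (dot := dot) (W := moment A) dot_norm) => [|J].
  by rewrite mulr_ge0 ?sqrtr_ge0.
rewrite exprMn -/(s (zmul j f) _).
pose J1 := [fset a in J | a j != 0%N]%fset.
pose J2 := [fset msub a (eps j) | a in J1]%fset.
have sle : \sum_(a <- J1) s (zmul j f) a <= C ^+ 2 * \sum_(b <- J2) s f b.
  rewrite [X in _ <= _ * X]big_imfset /=; last first.
    move=> a b; rewrite /J1 !inE /= -!lt0n => /andP[_ aj] /andP[_ bj] ab.
    by rewrite -(msubK aj) ab msubK.
  rewrite mulr_sumr big_seq [leRHS]big_seq; apply: ler_sum => a.
  rewrite /J1 !inE /= => /andP[_ aj]; rewrite /s /zmul (negPf aj).
  rewrite -{1}(@msubK _ a j) ?lt0n// (moment_eps (proj2 A_comm)) -exprMn.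
  by rewrite ler_pXn2r ?nnegrE ?mulr_ge0 ?nrm_ge0.
have -> : \sum_(a <- J) s (zmul j f) a = \sum_(a <- J1) s (zmul j f) a.
  rewrite /J1 -big_fset_condE [LHS](bigID (fun a => a j != 0%N))/=.
  rewrite [X in _ + X]big1 ?addr0// => a /negPn aj.
  by rewrite /s /zmul aj moment_zero nrm0 expr0n.
apply: (le_trans sle); rewrite ler_wpM2l ?exprn_ge0//.
exact: (@l2_sum_le R H dot dot_norm d (moment A)).
Qed.

(** Both sides are bounded in [f] and agree on monomials. *)
Lemma eval_zmul w j f : bpe dot A w -> hcar f ->
  eval_at w (zmul j f) = (w 0 j : R[i]) *: (eval_at w f : H).
Proof.
move=> wP hf; apply/eqP; rewrite -subr_eq0; apply/eqP.
have [CE EC] := eval_bounded dot_norm A_inv wP; have EP := eval_linear wP.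
have [C C0 zC] := zmul_bounded j.
pose phi g : H := eval_at w (zmul j g) - (w 0 j : R[i]) *: (eval_at w g : H).
rewrite -/(phi f).
apply: (@H2_ext R H dot dot_norm d A A_inv _ phi
  (`|CE| * C + nrm (w 0 j : R[i]) * `|CE|)) => // [g h hg hh|g hg|b x].
- have [hzg _] := zC g hg; have [hzh _] := zC h hh.
  by rewrite /phi zmulD !(hlinearD EP)// scalerDr opprD addrACA.
- have [hzg zg] := zC g hg.
  have EC' h : hcar h -> nrm (eval_at w h : H) <= `|CE| * hnorm h.
    move=> /EC /le_trans; apply.
    by rewrite ler_wpM2r ?sqrtr_ge0// ler_norm.
  rewrite (le_trans (nrmD _ _))// nrmN nrmZ mulrDl lerD//.
    by rewrite (le_trans (EC' _ hzg))// -mulrA ler_wpM2l.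
  by rewrite -mulrA ler_wpM2l ?nrm_ge0// EC'.
- by rewrite /phi zmul_mono !eval_mono// monomial_eps scalerA subrr.
Qed.

Lemma restriction_zmul j f : hcar f ->
  restriction (zmul j f) = Mz j (restriction f : Hkappa dot A).
Proof.
by move=> hf; apply/funext => w; apply: eval_zmul => //; exact: set_valP.
Qed.

Lemma zmul_adjoint j f : hcar f -> exists2 h, hcar h &
  forall g, hcar g -> hdot (zmul j g) f = hdot g h.
Proof.
move=> hf; have [C C0 zC] := zmul_bounded j.
apply: (@hriesz _ _ K0 Kc (fun g => hdot (zmul j g) f) (C * hnorm f)).
  move=> c g h hg hh; have [hzg _] := zC g hg; have [hzh _] := zC h hh.
  by rewrite zmulP (hilbert_dotP K0).
move=> g hg; have [hzg zg] := zC g hg.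
rewrite (le_trans (hcauchy_schwarz K0 hzg hf))// mulrAC.
by rewrite ler_wpM2r ?sqrtr_ge0.
Qed.

(** [zmul j] maps vanishing series to vanishing series, so its adjoint preserves
    their orthogonal complement. *)
Lemma zmul_adjoint_orth j f h : hcar f -> hcar h -> orth_vanishing f ->
  (forall g, hcar g -> hdot (zmul j g) f = hdot g h) -> orth_vanishing h.
Proof.
move=> hf hh of_ fh g hg g0; have [C _ /(_ g hg) [hzg _]] := zmul_bounded j.
rewrite (hilbert_dotC K0)// -fh// -(hilbert_dotC K0)// of_//.
by rewrite restriction_zmul// g0; apply/funext => w; rewrite /Mz scaler0.
Qed.

(** Elements of the function space pair like their lifts orthogonal to the
    vanishing power series, so adjoints can be computed on power series. *)
Lemma hadjoint_Mz j f h : hcar f -> hcar h -> orth_vanishing f ->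
  orth_vanishing h -> (forall g, hcar g -> hdot (zmul j g) f = hdot g h) ->
  hadjoint (@Mz R H dot d A j) (restriction f) = restriction h.
Proof.
move=> hf hh of_ oh fh.
have adj u : hcar u -> hdot (Mz j (restriction u : Hkappa dot A))
    (restriction f : Hkappa dot A) = hdot u h.
  move=> hu; have [C _ /(_ u hu) [hzu _]] := zmul_bounded j.
  by rewrite -restriction_zmul// (Hkappa_dot dot_norm A_inv)// fh.
set G := hadjoint _ _.
have [hG GP] : hcar G /\ forall U : Hkappa dot A, hcar U ->
    hdot (Mz j U) (restriction f : Hkappa dot A) = hdot U G.
  apply: (@xgetPex _ 0 [set x : Hkappa dot A | hcar x /\
    forall U : Hkappa dot A, hcar U ->
      hdot (Mz j U) (restriction f : Hkappa dot A) = hdot U x]).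
  exists (restriction h); split; first by exists h.
  by move=> _ [u hu <-]; rewrite adj// (Hkappa_dot dot_norm A_inv).
have [hg gG og] := min_liftP dot_norm A_inv hG; set g := min_lift G in hg gG og.
rewrite -gG; congr restriction; apply/eqP; rewrite -subr_eq0; apply/eqP.
have hgh := hcarB K0 hg hh.
apply: (hilbert_dot_eq0 K0) => //; rewrite [X in X = _](hdotBr K0)//.
rewrite -adj// GP; last by exists (g - h).
by rewrite -(Hkappa_dot dot_norm A_inv hgh hg og) gG subrr.
Qed.

Local Notation adj_eval w := (hadjoint (eval_at w)).

Lemma adj_eval_orth w x : bpe dot A w -> orth_vanishing (adj_eval w x : K).
Proof.
move=> wP g hg g0; have [hE EP] := eval_adjointP dot_norm A_inv wP x.
rewrite (hilbert_dotC K0)// -EP//.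
by move/restriction0P: g0 => ->//; rewrite linear0l rmorph0.
Qed.

Lemma kappa_atE w x : @kappa_at R H dot d A w x = restriction (adj_eval w x : K).
Proof. by []. Qed.

Lemma mindex_ind (P : mindex d -> Prop) : P 0 ->
  (forall b j, P b -> P (b + eps j)) -> forall b, P b.
Proof.
move=> P0 PS b; move: {2}(\sum_i b i)%N (erefl (\sum_i b i)%N) => n.
elim: n b => [|n IHn] b bn.
  have -> // : b = 0; apply/ffunP => i; rewrite ffunE.
  by move/eqP: bn; rewrite sum_nat_eq0 => /forallP /(_ i) /eqP.
have [j bj] : exists j, (0 < b j)%N.
  apply/existsP; rewrite -[[exists _, _]]negbK negb_exists; apply/negP => /forallP b0.
  move: bn; rewrite big1// => i _; apply/eqP; by rewrite -leqn0 leqNgt b0.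
rewrite -(msubK bj); apply: PS; apply: IHn.
move: bn; rewrite -{1}(msubK bj).
under eq_bigr do rewrite mindexDE.
rewrite big_split /= [X in (_ + X)%N = _ -> _](bigD1 j)//=.
rewrite [X in (_ + (_ + X))%N = _ -> _]big1; first by rewrite epsE eqxx addn0 addn1 => -[].
by move=> i ij; rewrite epsE (negPf ij).
Qed.

(** On monomials the eigenvalue equation for the adjoint shifts determines the
    pairing with [f] from the constant coefficient of [f] alone. *)
Lemma joint_eigenvector w f : bpe dot A w -> hcar f ->
  (forall j g, hcar g -> hdot (zmul j g) f = (w 0 j : R[i]) * hdot g f) ->
  f = adj_eval w (f 0).
Proof.
move=> wP hf fw; have [hE EP] := eval_adjointP dot_norm A_inv wP (f 0).
set g := adj_eval w (f 0) in hE EP *.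
apply/eqP; rewrite -subr_eq0; apply/eqP; have hfg := hcarB K0 hf hE.
apply: (hilbert_dot_eq0 K0) => //.
apply: (@H2_ext R H dot dot_norm d A A_inv _ (fun u : K => hdot u (f - g))
  (hnorm (f - g))) => // [u v hu hv|u hu|b x].
- exact: (hdotDl K0).
- by rewrite mulrC; exact: (hcauchy_schwarz K0).
have hb c : hcar (mono c x) by exact: mono_car.
apply/eqP; rewrite (hdotBr K0)// subr_eq0 -EP// eval_mono// linearZl_LR.
apply/eqP; elim/mindex_ind: b => [|b j IHb].
  rewrite /mono_series (single_dot (moment_linear A)) !moment0 /monomial.
  by rewrite big1 ?mul1r// => i _; rewrite ffunE.
by rewrite -zmul_mono fw// IHb monomial_eps mulrA.
Qed.

(** By [hadjoint_Mz], being a joint eigenvector is a statement about pairings of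
    series with the minimal lift [f] of [F]. *)
Theorem joint_kerE w : bpe dot A w ->
  joint_ker (fun j => hadjoint (@Mz R H dot d A j))
            (map_mx (Num.conj : R[i] -> R[i]) w) = range (@kappa_at R H dot d A w).
Proof.
move=> wP; apply/seteqP; split=> [F [hF FP]|_ [x _ <-]].
  have [hf Ff of_] := min_liftP dot_norm A_inv hF.
  set f := min_lift F in hf Ff of_.
  suff fE : f = adj_eval w (f 0).
    by exists (f 0) => //; rewrite kappa_atE -fE.
  apply: joint_eigenvector => // j g hg.
  have [h hh fh] := zmul_adjoint j hf; have oh := zmul_adjoint_orth hf hh of_ fh.
  rewrite fh//.
  have hcf := hcarZ K0 (Num.conj (w 0 j : R[i])) hf.
  suff -> : h = Num.conj (w 0 j : R[i]) *: f.
    by rewrite (hdotZr K0)// conjCK.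
  apply: (orth_lift_unique dot_norm A_inv) => //.
    by move=> u hu u0; rewrite (hdotZl K0)// of_// mulr0.
  have -> : restriction (Num.conj (w 0 j : R[i]) *: f) =
      Num.conj (w 0 j : R[i]) *: restriction f.
    apply/funext => z; rewrite /restriction (hlinearZ dot_norm A_inv)//.
    by apply: eval_linear; exact: set_valP.
  rewrite -(hadjoint_Mz hf hh of_ oh fh) Ff.
  by apply/eqP; rewrite -subr_eq0; apply/eqP; have := FP j; rewrite mxE.
have [hE EP] := eval_adjointP dot_norm A_inv wP x.
have oE := adj_eval_orth x wP.
rewrite kappa_atE; set g := adj_eval w x in hE EP oE *.
split; first by exists g.
move=> j; rewrite mxE.
have hcg := hcarZ K0 (Num.conj (w 0 j : R[i])) hE.
have ocg : orth_vanishing (Num.conj (w 0 j : R[i]) *: g).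
  by move=> u hu u0; rewrite (hdotZl K0)// oE// mulr0.
rewrite (hadjoint_Mz hE hcg oE ocg) => [|u hu].
  apply/eqP; rewrite subr_eq0; apply/eqP/funext => z.
  rewrite /restriction (hlinearZ dot_norm A_inv)//.
  by apply: eval_linear; exact: set_valP.
have [C _ /(_ u hu) [hzu _]] := zmul_bounded j.
by rewrite -EP// eval_zmul// linearZl_LR (hdotZr K0)// conjCK; congr (_ * _); exact: EP.
Qed.

(** The projection is made on series: the component [q] of the minimal lift [f]
    orthogonal to all representers of evaluations vanishes on [bpe], hence is
    orthogonal to [f] as well as to [f - q], and so is zero. *)
Theorem closed_span_kappa :
  closed_span (\bigcup_(w in bpe dot A) range (@kappa_at R H dot d A w)) =
  @hcar R (Hkappa dot A).
Proof.
apply/seteqP; split=> [F []//|F hF]; split=> // e e0.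
have [hf Ff of_] := min_liftP dot_norm A_inv hF; set f := min_lift F in hf Ff of_.
pose S : set K := [set g | exists w, bpe dot A w /\ exists x, g = adj_eval w x].
have SP g : S g -> hcar g /\ orth_vanishing g.
  move=> [w [wP [x ->]]]; split; last exact: adj_eval_orth.
  by have [] := eval_adjointP dot_norm A_inv wP x.
have Vsub : hsubspace (linear_span S).
  by apply: (linear_span_subspace K0) => g /SP [].
have [p [[hp pV] porth]] := hprojection K0 Kc Vsub hf.
have hq := hcarB K0 hf hp; set q := f - p in hq porth.
have q0 : restriction q = 0.
  apply/restriction0P => w wP.
  have Ex x : dot (eval_at w q) x = 0.
    have [hE EP] := eval_adjointP dot_norm A_inv wP x.
    rewrite EP//; apply: porth; exists 1%N, (fun _ => 1), (fun _ => adj_eval w x).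
    by split; [move=> _; exists w; split=> //; exists x|rewrite big_ord1 scale1r].
  by have /eqP := Ex (eval_at w q); rewrite dot_norm expf_eq0 normr_eq0 => /eqP.
have pq : hdot p q = 0.
  apply: (hclosure_orth K0 hq (hsubspace_car Vsub)) (conj hp pV) => v Vv.
  have hv := hsubspace_car Vsub Vv.
  by rewrite (hilbert_dotC K0)// porth// rmorph0.
have {}q0 : q = 0.
  apply: (hilbert_dot_eq0 K0) => //.
  by rewrite -[LHS]/(hdot (f - p) q) (hdotBl K0)// pq of_// subrr.
have fp : f = p by apply/eqP; rewrite -subr_eq0 -/q q0.
have [v Vv fv] := pV e e0; rewrite -fp in fv.
have hv := hsubspace_car Vsub Vv.
have [ov vS] : orth_vanishing v /\ linear_span
    (\bigcup_(w in bpe dot A) range (@kappa_at R H dot d A w)) (restriction v).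
  split.
    suff: [set g | hcar g /\ orth_vanishing g] v by case.
    apply: linear_span_min Vv => //; split=> [g []//||c g h [hg og] [hh oh]].
      by split=> [|h hh _]; [exact: hilbert0 K0|rewrite (hdot0l K0)].
    split; first exact: hilbertP K0 _ _ _ hg hh.
    by move=> u hu u0; rewrite (hilbert_dotP K0)// og// oh// mulr0 addr0.
  case: Vv => n [c [u [uS ->]]]; exists n, c, (fun i => restriction (u i)).
  split=> [i|].
    have [w [wP [x ->]]] := uS i; exists w => //; exists x => //.
  have hu i : hcar (u i) by have [] := SP _ (uS i).
  suff: restriction (\sum_(i < n) c i *: u i) =
      \sum_(i < n) c i *: restriction (u i) /\ hcar (\sum_(i < n) c i *: u i).
    by case.
  have restr0 : restriction (0 : K) = 0.
    by have [] := hsubspace0 (vanishing_subspace dot_norm A_inv).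
  elim/big_ind2: _ => [|? g1 ? g2 [<- h1] [<- h2]|i _].
  - by split; [exact: restr0|exact: hilbert0 K0].
  - split; last exact: (hcarD K0).
    by have := restrictionP 1 h1 h2; rewrite !scale1r.
  - split; last exact: (hcarZ K0).
    rewrite -[in LHS](addr0 (c i *: u i)) restrictionP//; last exact: hilbert0 K0.
    by rewrite restr0 addr0.
exists (restriction v) => //.
rewrite /hnorm -Ff -restrictionB//.
have hfv := hcarB K0 hf hv.
rewrite (Hkappa_dot dot_norm A_inv)// => u hu u0.
by rewrite (hdotBl K0)// of_// ov// subrr.
Qed.

End Shift.

(** * Recovering coefficients from point evaluations *)

Section Injectivity.
Variables (R : realType) (H : completeNormedModType R[i]).
Variable dot : {dot H for (Num.conj : R[i] -> R[i])}.
Hypothesis dot_norm : forall x : H, dot x x = `|x| ^+ 2.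
Variables (d : nat) (A : 'I_d -> mindex d -> {linear H -> H}).
Hypothesis A_inv : forall j a, invertible_operator (A j a).

Let K := H2 dot A.
Local Notation eval_at := (@Defs.eval R H dot d A).
Local Notation mono := (@mono_series R H dot d A).
Local Notation scale c f :=
  (@scale_coords R H dot d (moment A) c f : H2 dot A).
Implicit Types (w : 'rV[R[i]^o]_d) (f g : K) (a b : mindex d) (x : H).
Let K0 : prehilbert K := H2_prehilbert dot_norm A_inv.

Definition dilate j (t : R) f : K := scale (fun a => t%:C ^+ a j) f.

Definition dilate_point j (t : R) w : 'rV[R[i]^o]_d :=
  \row_i (if i == j then t%:C * (w 0 i : R[i]) else w 0 i).

Lemma monomial_dilate j t w b :
  monomial (dilate_point j t w) b = t%:C ^+ b j * monomial w b.
Proof.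
rewrite /monomial (bigD1 j)//= [in RHS](bigD1 j)//= mulrA mxE eqxx exprMn.
by congr (_ * _); apply: eq_bigr => i ij; rewrite mxE (negPf ij).
Qed.

Lemma dilate_le j t f : 0 <= t <= 1 -> hcar f ->
  hcar (dilate j t f) /\ hnorm (dilate j t f) <= hnorm f.
Proof.
move=> /andP[t0 t1] hf; rewrite -[X in _ /\ _ <= X]mul1r.
apply: H2_scale_le => // a _.
by rewrite -rmorphXn nrm_real ger0_norm ?exprn_ge0// exprn_ile1.
Qed.

(** Scaling the [j]-th coordinate of a point of [bpe] by [t] amounts to dilating
    the series first, which is a contraction; in particular the scaled point
    stays in [bpe]. *)
Lemma dilate_eval j t w : 0 <= t <= 1 -> bpe dot A w ->
  is_eval (dilate_point j t w) (fun f : K => eval_at w (dilate j t f)).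
Proof.
move=> t01 wP; have [C EC] := eval_bounded dot_norm A_inv wP.
have EP := eval_linear wP.
apply: (@is_evalI R H dot dot_norm d A A_inv _ _ `|C|) => [c f g hf hg|f hf|b x].
- have [hdf _] := dilate_le j t01 hf; have [hdg _] := dilate_le j t01 hg.
  rewrite -EP//; congr eval_at; apply/funext => a.
  by rewrite /dilate /scale_coords !fctE scalerDr !scalerA mulrC.
- have [hdf df] := dilate_le j t01 hf; apply: le_trans (EC _ hdf) _.
  apply: (@le_trans _ _ (`|C| * hnorm (dilate j t f))).
    by rewrite ler_wpM2r ?sqrtr_ge0// ler_norm.
  by rewrite ler_wpM2l.
- have -> : dilate j t (mono b x) = mono b (t%:C ^+ b j *: x).
    apply/funext => a; rewrite /dilate /scale_coords /mono_series /single.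
    by case: eqP => [->//|_]; rewrite scaler0.
  by rewrite eval_mono// scalerA monomial_dilate mulrC.
Qed.

Lemma vanishing_dilate j t f w : 0 <= t <= 1 -> vanishing f -> bpe dot A w ->
  eval_at w (dilate j t f) = 0.
Proof.
move=> t01 [hf /restriction0P f0] wP; have E := dilate_eval j t01 wP.
by rewrite -(eval_unique dot_norm A_inv E hf) f0//; exists (fun f => eval_at w (dilate j t f)).
Qed.

Definition part j (P : pred nat) f : K := scale (fun a => (P (a j))%:R) f.

Lemma part_car j P f : hcar f -> hcar (part j P f).
Proof.
move=> hf; have [] := @H2_scale_le R H dot dot_norm d A (fun a => (P (a j))%:R) 1 f => //.
move=> a _; case: (P (a j)); last by rewrite nrm0.
by rewrite /nrm normr1.
Qed.

(** If [f] starts at the power [k] of the variable [z_j], then [t^-k] times its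
    dilation by [t] tends to its lowest order part as [t] tends to [0]. *)
Lemma vanishing_lowest j k f : vanishing f ->
  (forall a, (a j < k)%N -> f a = 0) -> vanishing (part j (pred1 k) f).
Proof.
move=> fN fk; have [hf f0] := fN; have hp := part_car j (pred1 k) hf.
split=> //; apply/restriction0P => w wP.
have [C EC] := eval_bounded dot_norm A_inv wP; have EP := eval_linear wP.
have le_t (t : R) : 0 < t -> t <= 1 ->
    nrm (eval_at w (part j (pred1 k) f) : H) <= `|C| * hnorm f * t.
  move=> t0 t1; have t01 : 0 <= t <= 1 by rewrite ltW.
  have [hd _] := dilate_le j t01 hf.
  pose s : R[i] := (t ^- k)%:C.
  have -> : eval_at w (part j (pred1 k) f) =
      eval_at w (part j (pred1 k) f - s *: dilate j t f).
    rewrite (hlinearB EP)//; last exact: (hcarZ K0).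
    by rewrite (hlinearZ dot_norm A_inv)// vanishing_dilate// scaler0 subr0.
  (* [c a] vanishes for [a j = k] and is [- t ^+ (a j - k)] beyond *)
  pose c a : R[i] := (a j == k)%:R - (t ^- k * t ^+ a j)%:C.
  have -> : part j (pred1 k) f - s *: dilate j t f = scale c f.
    apply/funext => a; rewrite /part /dilate /scale_coords !fctE /c scalerBl.
    by rewrite scalerA rmorphM rmorphXn.
  have [a fa|hs sle] := @H2_scale_le R H dot dot_norm d A c t f (ltW t0) _ hf.
    have ka : (k <= a j)%N by rewrite leqNgt; apply/negP => /fk /eqP; apply/negP.
    have tk : t ^+ k != 0 by rewrite expf_neq0// gt_eqF.
    have -> : c a = ((a j == k)%:R - t ^+ (a j - k))%:C.
      rewrite /c -{2}(subnK ka) exprD mulrCA mulVf// mulr1 rmorphB.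
      by case: (a j == k).
    rewrite nrm_real; have [->|ak] := eqVneq (a j) k.
      by rewrite subnn expr0 subrr normr0 ltW.
    rewrite sub0r normrN ger0_norm; last exact: exprn_ge0 (ltW t0).
    have [m ->] : exists m, (a j - k)%N = m.+1 by exists (a j - k).-1; lia.
    by rewrite exprS ler_piMr ?exprn_ile1// ltW.
  apply: le_trans (EC _ hs) _; rewrite mulrAC.
  apply: (@le_trans _ _ (`|C| * hnorm (scale c f))).
    by rewrite ler_wpM2r ?sqrtr_ge0// ler_norm.
  by rewrite -mulrA ler_wpM2l// .
apply: nrm_eq0; apply/eqP; rewrite eq_le nrm_ge0 andbT leNgt; apply/negP.
set X := nrm _ in le_t * => X0; set D := `|C| * _ in le_t.
have D0 : 0 <= D by rewrite mulr_ge0// sqrtr_ge0.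
have q0 : 0 < X / (2 * (D + 1)) by rewrite divr_gt0// mulr_gt0// ltr_wpDl.
(* for this [t] the bound [D * t] is at most [X / 2] *)
pose t := Num.min 1 (X / (2 * (D + 1))).
have t0 : 0 < t by rewrite lt_min ltr01.
have t1 : t <= 1 by rewrite ge_min lexx.
have tX : t <= X / (2 * (D + 1)) by rewrite ge_min lexx orbT.
have := le_trans (le_t t t0 t1) (ler_wpM2l D0 tX).
by rewrite mulrA ler_pdivlMr ?mulr_gt0 ?ltr_wpDl//; nra.
Qed.

(** Induction on [k]: removing the part of degree exactly [k] in [z_j], which
    vanishes by [vanishing_lowest], raises the lowest degree by one. *)
Lemma vanishing_part j k f : vanishing f ->
  vanishing (part j (leq k) f) /\ vanishing (part j (pred1 k) f).
Proof.
move=> fN; have VS := vanishing_subspace dot_norm A_inv.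
have eqk k' : vanishing (part j (leq k') f) -> vanishing (part j (pred1 k') f).
  move=> kN; have -> : part j (pred1 k') f = part j (pred1 k') (part j (leq k') f).
    apply/funext => a; rewrite /part /scale_coords scalerA /=; congr (_ *: _).
    by case: eqP => [->|_]; rewrite ?leqnn ?mulr1 ?mul0r.
  apply: vanishing_lowest => // a ak.
  by rewrite /part /scale_coords leqNgt ak scale0r.
suff : vanishing (part j (leq k) f) by move=> h; split=> //; exact: eqk.
elim: k => [|k IHk].
  suff -> : part j (leq 0) f = f by [].
  by apply/funext => a; rewrite /part /scale_coords scale1r.
have -> : part j (leq k.+1) f = (-1) *: part j (pred1 k) f + part j (leq k) f.
  apply/funext => a; rewrite /part /scale_coords !fctE scalerA -scalerDl.
  by congr (_ *: _); rewrite /=; case: ltngtP; rewrite ?mulr0 ?add0r ?mulr1 ?addNr.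
by apply: (hsubspaceP VS) => //; exact: eqk.
Qed.

(** Select the exponent [b j] in each variable [z_j] in turn. *)
Lemma vanishing_mono b f : vanishing f -> vanishing (mono b (f b)).
Proof.
move=> fN.
have part_s (s : seq 'I_d) :
    vanishing (scale (fun a => (all (fun j => a j == b j) s)%:R) f).
  elim: s => [|j s IHs].
    suff -> : scale (fun a => (all (fun j => a j == b j) [::])%:R) f = f by [].
    by apply/funext => a; rewrite /scale_coords scale1r.
  have [_] := vanishing_part j (b j) IHs; congr vanishing; apply/funext => a.
  rewrite /part /scale_coords scalerA /=; congr (_ *: _).
  by case: (a j == b j); rewrite ?mul1r ?mul0r.
have := part_s (enum 'I_d); congr vanishing; apply/funext => a.
rewrite /scale_coords /mono_series /single.
have -> : all (fun j => a j == b j) (enum 'I_d) = (a == b).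
  apply/allP/eqP => [ab|-> //]; apply/ffunP => j; apply/eqP/ab.
  by rewrite mem_enum.
by case: eqP => [->|_]; rewrite ?scale1r ?scale0r.
Qed.

(** Zero coordinates of an interior point can be moved to [e / 2] inside a ball
    of radius [e]. *)
Lemma interior_nonzero : interior (bpe dot A) !=set0 ->
  exists2 w, bpe dot A w & forall j, (w 0 j : R[i]) != 0.
Proof.
move=> [w0 /nbhs_ballP [e /= e0 we]].
exists (\row_j (if (w0 0 j : R[i]) == 0 then e / 2 else w0 0 j)).
  apply: we; split=> // i j; rewrite mxE (ord1 i) -ball_normE /=.
  case: eqP => [->|_]; last by rewrite subrr normr0.
  by rewrite sub0r normrN gtr0_norm ?divr_gt0// ltr_pdivrMr// ltr_pMr// ltr1n.
move=> j; rewrite mxE; case: ifPn => // _.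
by rewrite gt_eqF// divr_gt0.
Qed.

Theorem restriction_injective : interior (bpe dot A) !=set0 ->
  forall f, hcar f -> restriction f = 0 -> f = 0.
Proof.
move=> /interior_nonzero [w wP w0] f hf f0; apply/funext => b.
have [_ /restriction0P /(_ w wP)] := @vanishing_mono b f (conj hf f0).
rewrite eval_mono// => /eqP; rewrite scaler_eq0 => /orP[|/eqP//].
rewrite /monomial => /prodf_eq0 [j _]; rewrite expf_eq0 => /andP[_ wj].
by have := w0 j; rewrite wj.
Qed.

End Injectivity.

(** * The multishift as multiplication by coordinates *)

Section UnitaryEquivalence.
Variables (R : realType) (H : completeNormedModType R[i]).
Variable dot : {dot H for (Num.conj : R[i] -> R[i])}.
Hypothesis dot_norm : forall x : H, dot x x = `|x| ^+ 2.
Variables (d : nat) (A : 'I_d -> mindex d -> {linear H -> H}).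
Hypothesis A_inv : forall j a, invertible_operator (A j a).
Hypothesis A_comm : commuting_multishift A.

Theorem multishift_Mz : interior (bpe dot A) !=set0 ->
  unitarily_equivalent (@multishift R H dot d A) (@Mz R H dot d A).
Proof.
move=> /(restriction_injective dot_norm A_inv) inj.
have orth (f : H2 dot A) : hcar f -> orth_vanishing f.
  move=> hf g hg /(inj g hg) ->; have K0 := H2_prehilbert dot_norm A_inv.
  by rewrite (hilbert_dotC K0 (hilbert0 K0) hf) (hdot0l K0)// rmorph0.
have /choice [Binv BK] : forall a, exists g : H -> H, cancel g (moment A a).
  by move=> a; have [g _ gK] := moment_bij A_inv a; exists g.
have BI a : injective (moment A a) by exact: bij_inj (moment_bij A_inv a).
pose V (x : l2 dot d) : H2 dot A := fun a => Binv a (x a).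
have VE x a : moment A a (V x a) = x a by rewrite /V BK.
have Vcar x : hcar (V x) <-> hcar x.
  by rewrite /hcar /=; under eq_esum do rewrite VE.
have Vdot x y : hdot (V x) (V y) = hdot x y.
  apply: (congr1 (@usum R (mindex d))); apply/funext => a.
  by rewrite !VE.
exists (fun x => restriction (V x)); split; [split|].
- move=> c x y hx hy; rewrite -restrictionP; [|exact: (proj2 (Vcar x))|exact: (proj2 (Vcar y))].
  congr restriction; apply/funext => a; apply: (BI a).
  by rewrite VE !fctE moment_linear !VE.
- apply/seteqP; split=> [_ [x hx <-]|_ [f hf <-]].
    by exists (V x) => //; exact: (proj2 (Vcar x)).
  pose x : l2 dot d := fun a => moment A a (f a).
  have Vf : V x = f by apply/funext => a; apply: (BI a); rewrite VE.
  by exists x; [apply: (proj1 (Vcar x)); rewrite Vf|rewrite Vf].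
- move=> x y /(proj2 (Vcar _)) hx /(proj2 (Vcar _)) hy.
  by rewrite (Hkappa_dot dot_norm A_inv)//; exact: orth.
move=> j x /(proj2 (Vcar _)) hx.
rewrite -(restriction_zmul dot_norm A_inv A_comm)//; congr restriction.
apply/funext => a; apply: (BI a); rewrite VE /multishift /zmul.
case: ifPn => [_|]; first by rewrite moment_zero.
rewrite -lt0n => aj; rewrite -{3}(msubK aj).
by rewrite (moment_eps (proj2 A_comm)) VE.
Qed.

End UnitaryEquivalence.

Theorem theorem5p7 (R : realType) (H : completeNormedModType R[i])
    (dot : {dot H for (Num.conj : R[i] -> R[i])})
    (dot_norm : forall x : H, dot x x = `|x| ^+ 2)
    (separable : exists2 S : set H, countable S & dense S)
    (d : nat) (d_gt0 : (0 < d)%N)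
    (A : 'I_d -> mindex d -> {linear H -> H})
    (A_inv : forall j a, invertible_operator (A j a))
    (A_comm : commuting_multishift A) :
  let ker_at (w : 'rV[R[i]^o]_d) : set (Hkappa dot A) :=
    joint_ker (fun j => hadjoint (@Mz R H dot d A j))
              (map_mx (Num.conj : R[i] -> R[i]) w) in
  [/\ forall w, bpe dot A w -> ker_at w = range (@kappa_at R H dot d A w),
      closed_span (\bigcup_(w in bpe dot A) ker_at w)
        = @hcar R (Hkappa dot A) &
      interior (bpe dot A) !=set0 ->
      unitarily_equivalent (@multishift R H dot d A) (@Mz R H dot d A)].
Proof.
move=> ker_at.
have kerE w : bpe dot A w -> ker_at w = range (@kappa_at R H dot d A w).
  exact: joint_kerE.
split; [exact: kerE| |exact: multishift_Mz].
rewrite -(closed_span_kappa dot_norm A_inv); congr closed_span.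
exact: eq_bigcupr.
Qed.
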